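(* Let $N\in\mathbb{N}$, $t\in\mathbb{R}$ and $z=x+iy$ with $|y|\le\delta\epsilon_N$. Let $E^{\min}_N(x,t):=\min_{S\subseteq\{1,\dots,N\}}E_{N,S}(x,t)$. Then $$0<\Big[d\Big(2\kappa_{\max}\tfrac{|y|}{\epsilon_N}\Big)\Big]^N\le|Z_N(z,t)|\le2^N\exp\Big(-\frac{2}{\pi\epsilon_N^2}E^{\min}_N(x,t)\Big),$$ where $d(\theta):=1$ for $0\le\theta\le\pi/2$ and $d(\theta):=\sin\theta$ for $\pi/2<\theta\le\pi$. In particular $Z_N(\cdot,t)$ has no zeros in the strip $|\operatorname{Im}z|\le\delta\epsilon_N$; moreover $Z_N(x,t)>0$ for real $x$, and with the argument of $Z_N(z,t)$ defined to be $0$ on $\mathbb{R}$ and continuous in the strip, $$0\le-\operatorname{sgn}(y)\arg Z_N(z,t)\le2N\kappa_{\max}\frac{|y|}{\epsilon_N}.$$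
   Context: Fix $\delta>0$ and an admissible initial condition $u_0$: $u_0:\mathbb{R}\to\mathbb{R}$ is $C^1$, $u_0>0$, $u_0(x)\to0$ as $x\to\pm\infty$, $\int(x^2+1)u_0<\infty$, $u_0'$ vanishes only at $x_{\max}$ where $u_0$ attains its maximum $u_{\max}$. Standing assumption: $\int_{\mathbb{R}}\sqrt{u_0}<\infty$. Lambert $W$: $W_n$ are the standard branches of the inverse of $w\mapsto we^w$; for real $a\in[-e^{-1},0)$, $W_0(a)\in[-1,0)$, $W_{-1}(a)\in(-\infty,-1]$; for real $a<-e^{-1}$, $W_0(a)$ is the solution of $we^w=a$ with $0<\operatorname{Im}w<\pi$ and $W_{-1}(a):=\overline{W_0(a)}$. $\zeta(\kappa):=\kappa\cot(2\delta\kappa)+i\kappa$ ($0<|\kappa|<\pi/(2\delta)$), $\zeta(0):=1/(2\delta)$; $E(\zeta):=-\zeta+\frac1{2\delta}(1+\operatorname{Log}(2\delta\zeta))$, real and increasing along $\kappa\mapsto\zeta(\kappa)$, $\kappa\in[0,\pi/(2\delta))$. $\zeta_{\max}:=-\frac1{2\delta}W_{-1}(-e^{2\delta u_{\max}-1})$, $\kappa_{\max}:=\operatorname{Im}\zeta_{\max}\in(0,\pi/(2\delta))$. For $\kappa\in(0,\kappa_{\max}]$, $x_-(\kappa)\le x_{\max}\le x_+(\kappa)$ solve $u_0(x)=E(\zeta(\kappa))$, $x_\pm(0)=\pm\infty$; $a(\kappa,u):=-2\delta\zeta(\kappa)e^{-2\delta(\zeta(\kappa)+u)}$ (real). $R^{\mathrm{Wyl}}(\kappa):=\frac1{4\delta}\int_{x_-(\kappa)}^{x_+(\kappa)}[W_0-W_{-1}](a(\kappa,u_0(x)))dx$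 (finite, strictly decreasing, $R^{\mathrm{Wyl}}(\kappa_{\max})=0$). $\theta_+(\kappa):=\kappa x_+(\kappa)+\int_{x_+(\kappa)}^{\infty}\operatorname{Im}[\zeta(\kappa)+\frac1{2\delta}W_{-1}(a(\kappa,u_0(x)))]dx$. Data: $\epsilon_N:=R^{\mathrm{Wyl}}(0)/(\pi N)$; $\kappa_n\in(0,\kappa_{\max})$ with $R^{\mathrm{Wyl}}(\kappa_n)=\pi(n-\frac12)\epsilon_N$, $\zeta_n:=\zeta(\kappa_n)$, $c_n:=\exp(2\theta_+(\kappa_n)/\epsilon_N)$, $1\le n\le N$. $D_N(z,t)$: diagonal with entries $c_n^{1/2}\exp(-\kappa_nz/\epsilon_N-\operatorname{Im}[(\zeta_n-\frac1{2\delta})^2]t/\epsilon_N)$; $[C_N]_{n\ell}:=i/(\zeta_\ell-\overline{\zeta_n})$; $\Delta_N:=D_NC_ND_N$; $Z_N(z,t):=\det(I_N+\Delta_N(z,t))$. Energies: $V(\kappa;z,t):=z\kappa+t\operatorname{Im}[(\zeta(\kappa)-\frac1{2\delta})^2]-\theta_+(\kappa)$; $g(\zeta,\lambda):=\log|(\zeta-\bar\lambda)/(\zeta-\lambda)|$ for $\zeta\ne\lambda$ and $g(\zeta,\zeta):=\log|\zeta-\bar\zeta|$. For $S\subseteq\{1,\dots,N\}$, $E_{N,S}(z,t):=\pi\epsilon_N\sum_{n\in S}V(\kappa_n;z,t)+\frac{\pi\epsilon_N^2}{2}\sum_{n,\ell\in S}g(\zeta_n,\zeta_\ell)$ ($E_{N,\emptyset}=0$).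 One has $Z_N(z,t)=\sum_{S}\exp(-\frac{2}{\pi\epsilon_N^2}E_{N,S}(z,t))$. *)

(* Defs.v *)
From Stdlib Require Import Reals ClassicalEpsilon.
From Coquelicot Require Import Rcomplements Rbar Hierarchy RInt RInt_gen Lim_seq Derive Continuity.
From mathcomp Require Import all_boot all_algebra.
From mathcomp Require Import Rstruct complex.

Set Implicit Arguments.
Unset Strict Implicit.
Unset Printing Implicit Defensive.

Open Scope R_scope.

Definition RtoC (r : R) : R[i] := Complex r 0.

Definition cabs (z : R[i]) : R := sqrt (Re z ^ 2 + Im z ^ 2).

Definition cconj (z : R[i]) : R[i] := Complex (Re z) (- Im z).

Definition cexp (w : R[i]) : R[i] :=
  Complex (exp (Re w) * cos (Im w)) (exp (Re w) * sin (Im w)).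

(* principal argument in (-pi, pi] (junk value for z = 0) *)
Definition Arg (z : R[i]) : R :=
  epsilon (inhabits 0) (fun th => - PI < th <= PI /\
     Re z = cabs z * cos th /\ Im z = cabs z * sin th).

Definition CLog (z : R[i]) : R[i] := Complex (ln (cabs z)) (Arg z).

Definition W0_spec (a : R) (w : R[i]) : Prop :=
  (w * cexp w)%R = RtoC a /\
  ((- exp (-1) <= a < 0 /\ Im w = 0 /\ -1 <= Re w < 0) \/
   (a < - exp (-1) /\ 0 < Im w < PI)).

Definition LambertW0 (a : R) : R[i] := epsilon (inhabits (RtoC 0)) (W0_spec a).

Definition Wm1_spec (a : R) (w : R[i]) : Prop :=
  (w * cexp w)%R = RtoC a /\ Im w = 0 /\ Re w <= -1.

Definition LambertWm1 (a : R) : R[i] :=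
  if Rlt_dec a (- exp (-1)) then cconj (LambertW0 a)
  else epsilon (inhabits (RtoC 0)) (Wm1_spec a).

Section Data.
Variables (delta : R) (u0 : R -> R) (xmax : R).

Definition umax : R := u0 xmax.

Definition zeta (kappa : R) : R[i] :=
  if Req_EM_T kappa 0 then RtoC (/ (2 * delta))
  else Complex (kappa * (cos (2 * delta * kappa) / sin (2 * delta * kappa))) kappa.

Definition Efun (z : R[i]) : R[i] :=
  (- z + RtoC (/ (2 * delta)) * (1 + CLog (RtoC (2 * delta) * z)))%R.

(* E(zeta(kappa)), which is real: we take its real part *)
Definition Ek (kappa : R) : R := Re (Efun (zeta kappa)).

Definition zeta_max : R[i] :=
  (- RtoC (/ (2 * delta)) * LambertWm1 (- exp (2 * delta * umax - 1)))%R.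

Definition kappa_max : R := Im zeta_max.

Definition xplus (kappa : R) : R :=
  epsilon (inhabits 0) (fun x => xmax <= x /\ u0 x = Ek kappa).
Definition xminus (kappa : R) : R :=
  epsilon (inhabits 0) (fun x => x <= xmax /\ u0 x = Ek kappa).

(* a(kappa,u) = -2 delta zeta e^{-2 delta (zeta + u)}, which is real *)
Definition aa (kappa u : R) : R :=
  Re (- (RtoC (2 * delta) * zeta kappa) *
      cexp (- (RtoC (2 * delta) * (zeta kappa + RtoC u))))%R.

Definition Wyl_integrand (kappa : R) (x : R) : R :=
  Re (LambertW0 (aa kappa (u0 x)) - LambertWm1 (aa kappa (u0 x)))%R.

(* R^Wyl(kappa); for kappa = 0, x_-(0) = -oo and x_+(0) = +oo *)
Definition RWyl (kappa : R) : R :=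
  / (4 * delta) *
  (if Req_EM_T kappa 0 then
     RInt_gen (Wyl_integrand kappa) (Rbar_locally m_infty) (Rbar_locally p_infty)
   else RInt (Wyl_integrand kappa) (xminus kappa) (xplus kappa)).

Definition theta_plus (kappa : R) : R :=
  kappa * xplus kappa +
  RInt_gen (fun x => Im (zeta kappa
                         + RtoC (/ (2 * delta)) * LambertWm1 (aa kappa (u0 x)))%R)
           (at_point (xplus kappa)) (Rbar_locally p_infty).

Section WithN.
Variable N : nat.

Definition epsN : R := RWyl 0 / (PI * INR N).

Definition kappa_n (n : nat) : R :=
  epsilon (inhabits 0) (fun k => 0 < k < kappa_max /\
     RWyl k = PI * (INR n - / 2) * epsN).

Definition zeta_n (n : nat) : R[i] := zeta (kappa_n n).

Definition c_n (n : nat) : R := exp (2 * theta_plus (kappa_n n) / epsN).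

(* the matrices are indexed by i : 'I_N, standing for n = i + 1 *)
Definition DN (z : R[i]) (t : R) : 'M[R[i]]_N :=
  diag_mx (\row_(i < N)
    (RtoC (sqrt (c_n i.+1)) *
     cexp (- (RtoC (kappa_n i.+1 / epsN) * z)
           - RtoC (Im ((zeta_n i.+1 - RtoC (/ (2 * delta))) ^+ 2) * t / epsN)))%R).

Definition CN : 'M[R[i]]_N :=
  \matrix_(i < N, l < N) ('i%C / (zeta_n l.+1 - cconj (zeta_n i.+1)))%R.

Definition DeltaN (z : R[i]) (t : R) : 'M[R[i]]_N := (DN z t *m CN *m DN z t)%R.

Definition ZN (z : R[i]) (t : R) : R[i] := (\det (1%:M + DeltaN z t))%R.

Definition Vk (kappa z t : R) : R :=
  z * kappa + t * Im ((zeta kappa - RtoC (/ (2 * delta))) ^+ 2)%R - theta_plus kappa.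

Definition gfun (z w : R[i]) : R :=
  if z == w then ln (cabs (z - cconj z)%R)
  else ln (cabs ((z - cconj w) / (z - w))%R).

Definition ENS (S : {set 'I_N}) (x t : R) : R :=
  PI * epsN * (\big[Rplus/0]_(i in S) Vk (kappa_n i.+1) x t)
  + PI * epsN ^ 2 / 2 *
    (\big[Rplus/0]_(i in S) \big[Rplus/0]_(l in S) gfun (zeta_n i.+1) (zeta_n l.+1)).

(* E^min_N(x,t) = min over all subsets S of {1..N}; the empty set is used as
   initial value of the iterated min (it is itself one of the candidates) *)
Definition EminN (x t : R) : R :=
  \big[Rmin/ENS set0 x t]_(S : {set 'I_N}) ENS S x t.

End WithN.
End Data.

Definition dfun (th : R) : R := if Rle_dec th (PI / 2) then 1 else sin th.

Definition sgn (y : R) : R :=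
  if Rlt_dec 0 y then 1 else if Rlt_dec y 0 then -1 else 0.

(* continuity of phi : R -> R -> R (phi x y at z = x + i y) on the closed strip
   |y| <= h, relative to the strip *)
Definition continuous_on_strip (h : R) (phi : R -> R -> R) : Prop :=
  forall x y, Rabs y <= h -> forall eps, 0 < eps -> exists del, 0 < del /\
    forall x' y', Rabs y' <= h -> Rabs (x' - x) < del -> Rabs (y' - y) < del ->
      Rabs (phi x' y' - phi x y) < eps.

(* Main.v *)
Require Import Defs.
From Stdlib Require Import Reals Lra Ranalysis5 ClassicalEpsilon FunctionalExtensionality.
From Coquelicot Require Import Rcomplements Rbar Hierarchy RInt RInt_gen Lim_seq Derive Continuity AutoDerive.
From mathcomp Require Import all_boot all_order all_algebra.
From mathcomp Require Import Rstruct complex.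
From mathcomp Require ring.
Open Scope R_scope.

(* With w_n the square of the n-th entry of D_N, one has Z = det (1 + C W), W = diag w, where the
   Cauchy matrix C is Hermitian positive definite.  In the strip the w_n lie in the closed sector
   between the directions 1 and exp (- i th), th = 2 kappa_max y / eps, |th| < pi.
   - If v C W = mu v then mu * conj s >= 0 with s = sum |v_n|^2 w_n / |w_n|^2 in the sector, so the
     eigenvalues mu of C W lie in the sector, where |1 + mu| >= d(|th|).  This bounds |Z| from below.
   - Z = det C * det (C^-1 + W), and each ratio of successive minors of C^-1 + W lies in the sector.
     The sum of the N principal arguments of these ratios is the continuous argument of Z.
   - Eliminating one row of C gives again a Cauchy matrix, conjugated by a diagonal of Blaschke
     factors, so positivity, det C > 0 and the expansion of Z over subsets S go by induction on N.
   The kappa_n exist by the intermediate value theorem.  On [x_-, x_+] the branches W_0 and W_{-1}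
   are real and the integrand of R^Wyl is G (2 delta (u_0(x) - E(zeta(kappa)))) with G >= 0
   and |G s - G s'| <= 2 r + 2 sqrt (2 r), r = |s - s'|.  This makes the integral
   continuous in E, and dominated by a multiple of the integral of sqrt u_0. *)

(** * Positive semidefinite forms and convex cones *)

(** The eigenvalues of C W control |Z| but not the argument, because numbering them continuously in
    z is a problem of its own, whereas successive minors are visibly continuous. Conversely, the
    minor ratios of C^-1 + W lie in the sector but may come close to 0, so the lower bound keeps the
    eigenvalues of 1 + C W. Both routes use only that the sector is a pointed convex cone containing
    1, hence the abstract cone [K] below. The branches of W, the points x_- and x_+, and the kappa_n
    are all chosen by [epsilon]; nothing is known about them until a witness is exhibited. For
    kappa_n the intermediate value theorem runs in the energy E instead of kappa: cutting the
    integrand off at 0 where u_0 < E allows a fixed interval of integration, while [x_-, x_+] moves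
    with kappa. *)

Section HermitianForms.
Local Set Implicit Arguments.
Local Unset Strict Implicit.
Local Unset Printing Implicit Defensive.
Import GRing.Theory Num.Theory Order.TTheory mathcomp.algebra_tactics.ring.
Local Open Scope ring_scope.
Variable C : numClosedFieldType.

Definition hform n (G : 'M[C]_n) (v : 'I_n -> C) : C :=
  \sum_i \sum_j v i * G i j * (v j)^*.

(** In a [numClosedFieldType], [0 <= x] includes that x is real, so this also carries the Hermitian
    symmetry of [G]. *)
Definition psd n (G : 'M[C]_n) : Prop := forall v, 0 <= hform G v.

Lemma hform_colsum n (G : 'M[C]_n) v :
  hform G v = \sum_j (\sum_i v i * G i j) * (v j)^*.
Proof.
rewrite /hform exchange_big /=; apply: eq_bigr => j _.
by rewrite mulr_suml.
Qed.

Lemma psd_minor n (G : 'M[C]_n.+1) : psd G -> psd (row' ord0 (col' ord0 G)).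
Proof.
move=> hG v; have := hG (fun i => oapp v 0 (unlift ord0 i)).
rewrite /hform big_ord_recl big1 ?add0r => [|j _]; last by rewrite unlift_none !mul0r.
congr (_ <= _); apply: eq_bigr => i _.
rewrite big_ord_recl unlift_none rmorph0 mulr0 add0r.
by apply: eq_bigr => j _; rewrite !mxE !liftK.
Qed.

(** Block LU factorization with pivot [M ord0 ord0]; [A] is [M] retyped with size 1 + n for the
    block lemmas. *)
Lemma det_schur n (M : 'M[C]_n.+1) : M ord0 ord0 != 0 ->
  \det M = M ord0 ord0 *
    \det (\matrix_(i < n, j < n) (M (lift ord0 i) (lift ord0 j)
       - M (lift ord0 i) ord0 * M ord0 (lift ord0 j) / M ord0 ord0)).
Proof.
move=> M0.
pose A := M : 'M_(1 + n, 1 + n).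
pose a : C := M ord0 ord0.
have l0 (k : 'I_1) : lshift n k = ord0 :> 'I_(1 + n) by rewrite [k]ord1; apply/val_inj.
have rl (i : 'I_n) : rshift 1 i = lift ord0 i :> 'I_(1 + n) by apply/val_inj.
have EM : (M : 'M_(1 + n)) = (block_mx 1%:M 0 (a^-1 *: dlsubmx A) 1%:M : 'M_(1 + n)) *m
   block_mx (ulsubmx A) (ursubmx A) 0
     (\matrix_(i < n, j < n) (M (lift ord0 i) (lift ord0 j)
       - M (lift ord0 i) ord0 * M ord0 (lift ord0 j) / M ord0 ord0)).
  rewrite -[LHS](@submxK _ 1 n 1 n M) mulmx_block !mul1mx !mul0mx !addr0.
  apply: f_equal2; last first.
    apply/matrixP => i j; rewrite !mxE big_ord1 !mxE !l0 !rl /A.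
    by rewrite -/a; ring.
  apply/matrixP => i j; rewrite !mxE big_ord1 !mxE !l0 -/a.
  by rewrite mulrAC mulVf // mul1r.
rewrite [\det _ in LHS](congr1 determinant EM) det_mulmx det_lblock det_ublock !det1 !mul1r.
rewrite det_mx11 !mxE !l0; by [].
Qed.

(** The determinant is affine in row 0. In the expansion of Z this separates the subsets without
    index 0 from those containing it. *)
Lemma det_split_row0 n (M M' : 'M[C]_n.+1) :
  (forall i j, M i j = (i == ord0)%:R * (j == ord0)%:R + M' i j) ->
  \det M = \det (row' ord0 (col' ord0 M)) + \det M'.
Proof.
move=> hM.
rewrite (expand_det_row M ord0) (expand_det_row M' ord0).
have cof j : cofactor M ord0 j = cofactor M' ord0 j.
  rewrite /cofactor; congr (_ * \det _); apply/matrixP => a b; rewrite !mxE hM.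
  by rewrite [lift _ _ == _]eq_sym (negbTE (neq_lift _ _)) mul0r add0r.
transitivity (\sum_j ((j == ord0)%:R * cofactor M ord0 j + M' ord0 j * cofactor M' ord0 j)).
  by apply: eq_bigr => j _; rewrite hM eqxx mul1r mulrDl cof.
rewrite big_split /=; congr (_ + _).
rewrite (bigD1 ord0) //= big1 ?addr0 => [|j /negbTE->]; last by rewrite mul0r.
by rewrite mul1r /cofactor /= expr0 mul1r.
Qed.

Section Cone.
Variable K : C -> Prop.
Hypothesis K1 : K 1.
Hypothesis KD : forall a b, K a -> K b -> K (a + b).
Hypothesis KZ : forall t a, 0 <= t -> K a -> K (t * a).
(** For a sector this means an opening below pi; it makes a vanishing sum of cone elements vanish
    term by term. *)
Hypothesis Kpointed : forall a b, K a -> K b -> a + b = 0 -> a = 0.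

Lemma cone_ge0 t : 0 <= t -> K t.
Proof. by move=> t0; rewrite -[t]mulr1; apply: KZ. Qed.

Lemma cone_sum (I : finType) (P : pred I) (F : I -> C) :
  (forall i, K (F i)) -> K (\sum_(i | P i) F i).
Proof.
move=> hF; apply: (big_ind K) => //; first exact: cone_ge0.
Qed.

Lemma cone_sum_eq0 (I : finType) (F : I -> C) :
  (forall i, K (F i)) -> \sum_i F i = 0 -> forall i, F i = 0.
Proof.
move=> hF h i; move: h; rewrite (bigD1 i) //=.
by apply: Kpointed => //; apply: cone_sum.
Qed.

(** The weights [c] are 1 for the form of W, and 1 / |w|^2 for the conjugate of the form of W^-1. *)
Lemma cone_diag_neq0 n (c : 'I_n -> C) (v w : 'I_n -> C) :
  (forall i, K (w i)) -> (forall i, w i != 0) -> (forall i, 0 < c i) ->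
  (exists i, v i != 0) -> \sum_i c i * `|v i| ^+ 2 * w i != 0.
Proof.
move=> Kw w0 c0 [i vi]; apply/eqP => h.
have hK j : K (c j * `|v j| ^+ 2 * w j).
  by apply: KZ => //; rewrite mulr_ge0 ?exprn_ge0 // ltW.
have /eqP := cone_sum_eq0 hK h i.
by rewrite !mulf_eq0 normr_eq0 (negbTE vi) (negbTE (w0 i)) gt_eqF.
Qed.

(** The factor [1 *] gives the sum the shape of [cone_diag_neq0] with constant weights. *)
Lemma hform_add_diag n (G : 'M[C]_n) (w v : 'I_n -> C) :
  hform (G + diag_mx (\row_i w i)) v = hform G v + \sum_i 1 * `|v i| ^+ 2 * w i.
Proof.
rewrite /hform -big_split /=; apply: eq_bigr => i _.
transitivity (\sum_j (v i * G i j * (v j)^* + v i * (w i *+ (i == j)) * (v j)^*)).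
  by apply: eq_bigr => j _; rewrite !mxE mulrDr mulrDl.
rewrite big_split /=; congr (_ + _).
rewrite (bigD1 i) //= big1 ?addr0 => [|j]; last first.
  by rewrite eq_sym => /negbTE->; rewrite mulr0n mulr0 mul0r.
by rewrite eqxx mulr1n mul1r normCK; ring.
Qed.

Variables (n : nat) (G : 'M[C]_n) (w : 'I_n -> C).
Hypotheses (Gpsd : psd G) (Kw : forall i, K (w i)) (w0 : forall i, w i != 0).

Lemma hform_add_diag_cone v : K (hform (G + diag_mx (\row_i w i)) v).
Proof.
rewrite hform_add_diag; apply: KD; first exact: cone_ge0.
by apply: cone_sum => i; apply: KZ => //; rewrite mul1r exprn_ge0.
Qed.

Lemma hform_add_diag_neq0 v : (exists i, v i != 0) ->
  hform (G + diag_mx (\row_i w i)) v != 0.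
Proof.
move=> hv; rewrite hform_add_diag; apply/eqP => h.
have /negP := cone_diag_neq0 (c := fun=> 1) Kw w0 (fun=> ltr01) hv; apply; apply/eqP.
rewrite addrC in h; apply: Kpointed h; last exact: cone_ge0.
by apply: cone_sum => i; apply: KZ => //; rewrite mul1r exprn_ge0.
Qed.

Lemma det_add_diag_neq0 : \det (G + diag_mx (\row_i w i)) != 0.
Proof.
apply/negP => /det0P [v v0 vB].
have hv : exists i, v 0 i != 0.
  by apply/rV0Pn.
have /negP := hform_add_diag_neq0 hv; apply.
rewrite hform_colsum big1 // => j _.
have := congr1 (fun u : 'rV_n => u 0 j) vB; rewrite mxE => ->.
by rewrite mxE mul0r.
Qed.

(* A left eigenvector [v] of [G W] satisfies [v G v^* = mu (v W^-1 v^* )], and [v W^-1 v^*] is the conjugate of a nonzero element of the cone. *)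
Lemma eigenvalue_psd_cone mu : eigenvalue (G *m diag_mx (\row_i w i)) mu -> K mu.
Proof.
case/eigenvalueP => v vA v0.
have hv : exists i, v 0 i != 0.
  by apply/rV0Pn.
have col j : \sum_i v 0 i * G i j = mu * v 0 j / w j.
  have := congr1 (fun u : 'rV_n => u 0 j) vA.
  rewrite mulmxA mul_mx_diag !mxE => <-.
  by rewrite mulfK.
pose c i := `|w i| ^- 2.
have c0 i : 0 < c i by rewrite invr_gt0 exprn_gt0 // normr_gt0.
have s0 := cone_diag_neq0 Kw w0 c0 hv.
have Ks : K (\sum_i c i * `|v 0 i| ^+ 2 * w i).
  by apply: cone_sum => i; apply: KZ => //; rewrite mulr_ge0 ?exprn_ge0 // ltW.
move: s0 Ks; set s := (\sum_i _) => s0 Ks.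
have E : hform G (v 0) = mu * s^*.
  rewrite hform_colsum /s rmorph_sum mulr_sumr; apply: eq_bigr => j _.
  rewrite col rmorphM /= [(c j * _)^*]geC0_conj; last by rewrite mulr_ge0 ?exprn_ge0 // ltW.
  rewrite /c !normCK; have w0j : (w j)^* != 0 by rewrite conjC_eq0.
  by have := w0 j; move=> wj; field; rewrite wj w0j.
have s0' : s^* != 0 by rewrite conjC_eq0.
have -> : mu = (hform G (v 0) / `|s| ^+ 2) * s.
  by rewrite E normCK; field; rewrite s0 s0'.
by apply: KZ => //; rewrite divr_ge0 // exprn_ge0.
Qed.

Lemma det_1_add_psd_diag : exists s : seq C,
  [/\ size s = n, forall mu, mu \in s -> K mu &
      \det (1%:M + G *m diag_mx (\row_i w i)) = \prod_(mu <- s) (1 + mu)].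
Proof.
set A := G *m _.
have [s hs] := closed_field_poly_normal (char_poly A).
rewrite (monicP (char_poly_monic A)) scale1r in hs.
have ss : size s = n.
  by have := size_char_poly A; rewrite hs size_prod_XsubC => -[].
exists s; split=> // [mu mus|].
  by apply: eigenvalue_psd_cone; rewrite eigenvalue_root_char hs root_prod_XsubC.
(* At -1 the characteristic polynomial gives det (-1 - A) = prod (-1 - mu); the signs (-1)^n
   cancel. *)
have := congr1 (fun p : {poly C} => p.[-1]) hs.
rewrite horner_prod /char_poly -horner_evalE -det_map_mx.
have -> : map_mx (horner_eval (-1)) (char_poly_mx A) = - (1%:M + A).
  apply/matrixP => i j; rewrite !mxE /horner_eval hornerD hornerN hornerC hornerMn hornerX.
  by rewrite mulNrn opprD.
rewrite -scaleN1r detZ => h.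
have -> : \det (1%:M + A) = (-1) ^+ n * ((-1) ^+ n * \det (1%:M + A)).
  by rewrite mulrA -exprMn mulrNN mul1r expr1n mul1r.
have nE : (-1) ^+ n = \prod_(mu <- s) (-1) :> C by rewrite big_const_seq count_predT ss iter_mulr_1.
rewrite h nE -big_split /=; apply: eq_bigr => i _.
by rewrite hornerXsubC; ring.
Qed.

End Cone.

(* The ratio is the inverse of [(B^-1)_00], and with [v] the first row of [B^-1], [v B v^*] is the conjugate of [(B^-1)_00]. *)
Lemma minor_ratio_cone (K : C -> Prop) n (G : 'M[C]_n.+1) (w : 'I_n.+1 -> C) :
  K 1 -> (forall a b, K a -> K b -> K (a + b)) ->
  (forall t a, 0 <= t -> K a -> K (t * a)) ->
  (forall a b, K a -> K b -> a + b = 0 -> a = 0) ->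
  psd G -> (forall i, K (w i)) -> (forall i, w i != 0) ->
  let B := G + diag_mx (\row_i w i) in K (\det B / \det (row' ord0 (col' ord0 B))).
Proof.
move=> K1 KD KZ Kp Gpsd Kw w0 B.
have B0 : \det B != 0 by apply: (@det_add_diag_neq0 K).
have Bu : B \in unitmx by rewrite unitmxE unitfE.
pose v : 'I_n.+1 -> C := fun i => invmx B ord0 i.
have vB (j : 'I_n.+1) : \sum_i v i * B i j = (ord0 == j)%:R :> C.
  by have := congr1 (fun M : 'M_n.+1 => M ord0 j) (mulVmx Bu); rewrite !mxE.
have hv : hform B v = (v ord0)^*.
  transitivity (\sum_(j < n.+1) (ord0 == j)%:R * (v j)^* : C).
    by rewrite hform_colsum; apply: eq_bigr => j _; congr (_ * _); apply: vB.
  rewrite (bigD1 ord0) //= big1 => [|j jn]; first by rewrite mul1r addr0.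
  by rewrite eq_sym (negbTE jn) mul0r.
have Kv : K (v ord0)^* by rewrite -hv; apply: hform_add_diag_cone.
have v0E : v ord0 = \det (row' ord0 (col' ord0 B)) / \det B.
  by rewrite /v /invmx Bu !mxE /cofactor /= expr0 mul1r mulrC.
have -> : \det B / \det (row' ord0 (col' ord0 B)) = `|v ord0| ^- 2 * (v ord0)^*.
  by rewrite -[LHS]invf_div -v0E invC_norm.
by apply: KZ => //; rewrite invr_ge0 exprn_ge0.
Qed.

End HermitianForms.

(** * The Cauchy matrix *)

Section CauchyMatrix.
Local Set Implicit Arguments.
Local Unset Strict Implicit.
Local Unset Printing Implicit Defensive.
Import GRing.Theory Num.Theory Order.TTheory mathcomp.algebra_tactics.ring.
Local Open Scope ring_scope.
Variable C : numClosedFieldType.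

Definition cauchy_mx n (z : 'I_n -> C) : 'M[C]_n :=
  \matrix_(i, j) ('i / (z j - (z i)^*)).

Definition blaschke (p a : C) : C := (a - p) / (a - p^*).

Definition in_upper_half n (z : 'I_n -> C) : Prop := forall i, 0 < 'Im (z i).

Lemma conj_sub_neq0 (a b : C) : 0 < 'Im a -> 0 < 'Im b -> a - b^* != 0.
Proof.
move=> a0 b0; apply: contraTneq (addr_gt0 a0 b0) => h.
have : 'Im (a - b^*) = 0 by rewrite h raddf0.
by rewrite raddfB /= Im_conj opprK => ->; rewrite ltxx.
Qed.

Section Step.
Variables (n : nat) (z : 'I_n.+1 -> C).
Hypothesis zI : in_upper_half z.
Let z' i := z (lift ord0 i).
Let f i := blaschke (z ord0) (z' i).

Lemma cauchy00 : cauchy_mx z ord0 ord0 = (2 * 'Im (z ord0))^-1.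
Proof.
rewrite mxE ImE mulrCA mulfV ?pnatr_eq0 // mulr1 invfM invCi.
by rewrite -[z _ - _]opprB invrN mulrN mulNr.
Qed.

Lemma cauchy00_gt0 : 0 < cauchy_mx z ord0 ord0.
Proof. by rewrite cauchy00 invr_gt0 mulr_gt0. Qed.

(** With b_i = conj z_i, this is the identity (z_0 - b_i)(z_j - b_0) - (z_0 - b_0)(z_j - b_i) = (z_j
    - z_0)(b_0 - b_i) over a common denominator. *)
Lemma cauchy_schur i j :
  cauchy_mx z (lift ord0 i) (lift ord0 j)
    - cauchy_mx z (lift ord0 i) ord0 * cauchy_mx z ord0 (lift ord0 j) / cauchy_mx z ord0 ord0
  = (f i)^* * cauchy_mx z' i j * f j.
Proof.
rewrite !mxE /f /blaschke rmorphM /= fmorphV !rmorphB /= conjCK -/(z' i) -/(z' j).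
have n0 := conj_sub_neq0 (zI ord0) (zI ord0).
have n1 := conj_sub_neq0 (zI ord0) (zI (lift ord0 i)).
have n2 := conj_sub_neq0 (zI (lift ord0 j)) (zI ord0).
have n3 := conj_sub_neq0 (zI (lift ord0 j)) (zI (lift ord0 i)).
have i0 := neq0Ci C.
have n1' : (z' i)^* - z ord0 != 0 by rewrite -opprB oppr_eq0.
rewrite -/(z' i) -/(z' j) in n1 n2 n3.
by field; rewrite n0 n1 n2 n3 i0 n1'.
Qed.

Lemma cauchy_conj m (y : 'I_m -> C) i j : (cauchy_mx y i j)^* = cauchy_mx y j i.
Proof.
rewrite !mxE rmorphM /= fmorphV rmorphB /= conjCK conjCi.
by rewrite -[y i - _]opprB invrN mulrN mulNr.
Qed.

(** Completing the square in [v ord0] leaves the form of the Schur complement, again a Cauchy form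
    by [cauchy_schur]. *)
Lemma hform_cauchy (v : 'I_n.+1 -> C) :
  hform (cauchy_mx z) v =
    cauchy_mx z ord0 ord0 * `|v ord0 + (\sum_i v (lift ord0 i) * cauchy_mx z (lift ord0 i) ord0)
       / cauchy_mx z ord0 ord0| ^+ 2
    + hform (cauchy_mx z') (fun i => v (lift ord0 i) * (f i)^*).
Proof.
set c := cauchy_mx z ord0 ord0; set a := \sum_i _.
have c0 : c != 0 by rewrite gt_eqF ?cauchy00_gt0.
have cr : c^* = c by rewrite cauchy_conj.
have aE : a^* = \sum_j cauchy_mx z ord0 (lift ord0 j) * (v (lift ord0 j))^*.
  by rewrite rmorph_sum; apply: eq_bigr => j _; rewrite rmorphM /= cauchy_conj mulrC.
have -> : hform (cauchy_mx z') (fun i => v (lift ord0 i) * (f i)^*) =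
   (\sum_i \sum_j v (lift ord0 i) * cauchy_mx z (lift ord0 i) (lift ord0 j) * (v (lift ord0 j))^*)
   - a * a^* / c.
  rewrite /hform aE /a mulr_suml mulr_suml -sumrB; apply: eq_bigr => i _.
  rewrite mulr_sumr mulr_suml -sumrB; apply: eq_bigr => j _.
  rewrite [(v (lift ord0 j) * _)^*]rmorphM /= conjCK.
  transitivity (v (lift ord0 i) * ((f i)^* * cauchy_mx z' i j * f j) * (v (lift ord0 j))^*).
    by ring.
  by rewrite -cauchy_schur -/c; ring.
rewrite /hform big_ord_recl big_ord_recl -/c.
under [X in _ + X]eq_bigr do rewrite big_ord_recl.
rewrite big_split /= normCK rmorphD /= [(a / c)^*]rmorphM /= [(c^-1)^*]fmorphV /= cr.
have -> : \sum_i v ord0 * cauchy_mx z ord0 (lift ord0 i) * (v (lift ord0 i))^* = v ord0 * a^*.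
  by rewrite aE mulr_sumr; apply: eq_bigr => i _; rewrite mulrA.
rewrite -mulr_suml -/a.
by field.
Qed.

Lemma det_cauchy_rec :
  \det (cauchy_mx z) = cauchy_mx z ord0 ord0 * (\prod_i `|f i| ^+ 2) * \det (cauchy_mx z').
Proof.
rewrite det_schur ?gt_eqF ?cauchy00_gt0 // -mulrA; congr (_ * _).
have -> : (\matrix_(i, j) (cauchy_mx z (lift ord0 i) (lift ord0 j) -
    cauchy_mx z (lift ord0 i) ord0 * cauchy_mx z ord0 (lift ord0 j) / cauchy_mx z ord0 ord0)) =
  diag_mx (\row_i (f i)^*) *m cauchy_mx z' *m diag_mx (\row_i f i).
  apply/matrixP => i j; rewrite mul_mx_diag mul_diag_mx.
  by move: (cauchy_schur i j); rewrite !mxE.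
rewrite !det_mulmx !det_diag mulrC mulrA -big_split; congr (_ * _).
by apply: eq_bigr => i _; rewrite !mxE normCK.
Qed.

(* [Z] with the two factors [D] of [1 + D C D] varied independently: eliminating row 0 multiplies one by the conjugates of the Blaschke factors and the other by the factors themselves. *)
Definition detP m (w w' : 'I_m -> C) (y : 'I_m -> C) : C :=
  \det (\matrix_(i, j) ((i == j)%:R + w i * cauchy_mx y i j * w' j)).

(** The first summand is the minor without index 0; the second is the pivot times the determinant of
    the Schur complement. *)
Lemma detP_rec (w w' : 'I_n.+1 -> C) :
  detP w w' z = detP (fun i => w (lift ord0 i)) (fun i => w' (lift ord0 i)) z'
    + w ord0 * w' ord0 * cauchy_mx z ord0 ord0 *
      detP (fun i => w (lift ord0 i) * (f i)^*) (fun i => w' (lift ord0 i) * f i) z'.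
Proof.
have c0 : cauchy_mx z ord0 ord0 != 0 by rewrite gt_eqF ?cauchy00_gt0.
rewrite /detP.
(* The diagonal 1 is dropped in row 0 only, which leaves the pivot w_0 C_00 w'_0. *)
pose M' : 'M[C]_n.+1 := \matrix_(i, j) ((i == j)%:R *+ (i != ord0) + w i * cauchy_mx z i j * w' j).
rewrite (@det_split_row0 _ _ _ M') => [|i j]; last first.
  rewrite ![in RHS]mxE ![in LHS]mxE addrA; congr (_ + _).
  by have [->|n0] := eqVneq i ord0; rewrite /= ?mul1r ?mulr0n ?addr0 ?mul0r ?add0r ?mulr1n // eq_sym.
congr (_ + _).
  congr (\det _); apply/matrixP => i j; rewrite !mxE.
  by rewrite (inj_eq lift_inj).
(* A zero weight makes row 0 or column 0 of [M'] vanish; otherwise the pivot is nonzero and can be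
   eliminated. *)
have [w0|w0] := eqVneq (w ord0 * w' ord0) 0.
  rewrite w0 !mul0r; move/eqP: w0; rewrite mulf_eq0 => /orP [] /eqP w0.
    rewrite (expand_det_row _ ord0) big1 // => j _.
    by rewrite [M' _ _]mxE /= w0 !mul0r mulr0n addr0 mul0r.
  rewrite (expand_det_col _ ord0) big1 // => i _.
  rewrite [M' _ _]mxE w0 mulr0 addr0.
  by case: (i == ord0); rewrite ?mulr0n mul0r.
have M00 : M' ord0 ord0 = w ord0 * cauchy_mx z ord0 ord0 * w' ord0.
  by rewrite mxE /= mulr0n add0r.
rewrite det_schur M00; last by rewrite mulrAC mulf_neq0.
rewrite [w ord0 * _ * w' ord0]mulrAC; congr (_ * _); congr determinant.
apply/matrixP => i j; rewrite [LHS]mxE [RHS]mxE.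
have := cauchy_schur i j.
have MS a b : M' a b = (a == b)%:R *+ (a != ord0) + w a * cauchy_mx z a b * w' b by rewrite mxE.
rewrite !MS /= !mulr0n !mulr1n !add0r (inj_eq lift_inj).
move: c0 w0; rewrite mulf_eq0 negb_or => c0 /andP [w0 w0'].
set A := cauchy_mx z _ _; set B := cauchy_mx z _ _; set D := cauchy_mx z _ _; set E := cauchy_mx z _ _.
move=> S.
transitivity ((i == j)%:R + w (lift ord0 i) * ((f i)^* * cauchy_mx z' i j * f j) * w' (lift ord0 j)).
  by rewrite -S; field; rewrite w0 w0' c0.
by ring.
Qed.

End Step.

Lemma psd_cauchy n (z : 'I_n -> C) : in_upper_half z -> psd (cauchy_mx z).
Proof.
elim: n z => [|n IH] z zI v; first by rewrite /hform big_ord0.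
rewrite hform_cauchy // addr_ge0 //; last by apply: IH => i; apply: zI.
by rewrite mulr_ge0 ?exprn_ge0 // ltW // cauchy00_gt0.
Qed.

Lemma blaschke_neq0 (p a : C) : 0 < 'Im p -> 0 < 'Im a -> a != p -> blaschke p a != 0.
Proof. by move=> p0 a0 ap; rewrite mulf_neq0 ?subr_eq0 // invr_eq0 conj_sub_neq0. Qed.

Lemma det_cauchy_gt0 n (z : 'I_n -> C) : in_upper_half z -> injective z -> 0 < \det (cauchy_mx z).
Proof.
elim: n z => [|n IH] z zI zinj; first by rewrite det_mx00.
have zI' : in_upper_half (fun i => z (lift ord0 i)) by move=> i; apply: zI.
have zinj' : injective (fun i => z (lift ord0 i)) by move=> i j /zinj /lift_inj.
rewrite det_cauchy_rec // mulr_gt0 ?IH // mulr_gt0 ?cauchy00_gt0 //.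
apply: prodr_gt0 => i _; rewrite exprn_gt0 // normr_gt0 blaschke_neq0 //.
by apply/eqP => /zinj /eqP; rewrite eq_sym (negbTE (neq_lift _ _)).
Qed.

(** * Expansion of the determinant over subsets of indices *)

Definition coupling (a b : C) : C :=
  if a == b then `|a - a^*|^-1 else `|(a - b) / (a - b^*)|.

(* The principal minor of [diag W * C] on [b], by Cauchy's formula; [coupling z w] is [exp (- gfun z w)]. *)
Definition subset_weight n (W : 'I_n -> C) (z : 'I_n -> C) (b : 'I_n -> bool) : C :=
  \prod_(i | b i) (W i * \prod_(j | b j) coupling (z i) (z j)).

Lemma coupling_sym a b : coupling a b = coupling b a.
Proof.
rewrite /coupling eq_sym; have [->//|_] := eqVneq b a.
rewrite !normrM !normfV distrC; congr (_ / _).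
by rewrite -[LHS]norm_conjC rmorphB /= conjCK distrC.
Qed.

Lemma big_ord_recl_cond (n : nat) (b : 'I_n.+1 -> bool) (F : 'I_n.+1 -> C) :
  \prod_(i | b i) F i =
  (if b ord0 then F ord0 else 1) * \prod_(i | b (lift ord0 i)) F (lift ord0 i).
Proof. by rewrite big_mkcond big_ord_recl; congr (_ * _); rewrite [RHS]big_mkcond. Qed.

Definition bcons n (b0 : bool) (b : 'I_n -> bool) : 'I_n.+1 -> bool :=
  fun i => oapp b b0 (unlift ord0 i).

Lemma subset_weight_false n (W z : 'I_n.+1 -> C) b :
  subset_weight W z (bcons false b) =
  subset_weight (fun i => W (lift ord0 i)) (fun i => z (lift ord0 i)) b.
Proof.
rewrite /subset_weight big_ord_recl_cond /bcons unlift_none /= mul1r.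
apply: eq_big => [i|i _]; first by rewrite liftK.
congr (_ * _); rewrite big_ord_recl_cond unlift_none /= mul1r.
by apply: eq_bigl => j; rewrite liftK.
Qed.

(** Index 0 meets each other i twice, as (0, i) and (i, 0). By symmetry this contributes the squared
    modulus of a Blaschke factor, which is absorbed into the weight of i. *)
Lemma subset_weight_true n (W z : 'I_n.+1 -> C) b : in_upper_half z -> injective z ->
  subset_weight W z (bcons true b) = W ord0 * cauchy_mx z ord0 ord0 *
  subset_weight (fun i => W (lift ord0 i) * `|blaschke (z ord0) (z (lift ord0 i))| ^+ 2)
     (fun i => z (lift ord0 i)) b.
Proof.
move=> zI zinj.
rewrite /subset_weight big_ord_recl_cond /bcons unlift_none /=.
rewrite big_ord_recl_cond unlift_none /=.
have -> : coupling (z ord0) (z ord0) = cauchy_mx z ord0 ord0.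
  rewrite /coupling eqxx -[RHS]ger0_norm ?ltW ?cauchy00_gt0 // mxE.
  by rewrite normrM normfV normCi mul1r.
rewrite -!mulrA; congr (_ * (_ * _)).
rewrite (eq_bigl b) => [|i]; last by rewrite liftK.
rewrite [X in _ * X](eq_bigl b) => [|i]; last by rewrite liftK.
rewrite -big_split /=; apply: eq_bigr => i _.
rewrite big_ord_recl_cond unlift_none /= [X in _ * (_ * (_ * X))](eq_bigl b) => [|j]; last by rewrite liftK.
rewrite [coupling (z ord0) _]coupling_sym.
have -> : coupling (z (lift ord0 i)) (z ord0) = `|blaschke (z ord0) (z (lift ord0 i))|.
  rewrite /coupling ifN //; apply/eqP => /zinj /eqP.
  by rewrite eq_sym (negbTE (neq_lift _ _)).
by ring.
Qed.

(* The determinant is the sum of its principal minors, here bounded term by term. *)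
Lemma norm_detP_le n (z w w' : 'I_n -> C) (B : C) : in_upper_half z -> injective z ->
  (forall b, subset_weight (fun i => `|w i * w' i|) z b <= B) ->
  `|detP w w' z| <= 2 ^+ n * B.
Proof.
elim: n z w w' B => [|n IH] z w w' B zI zinj hB.
  rewrite /detP det_mx00 normr1 mul1r.
  by have := hB (fun=> true); rewrite /subset_weight big_ord0.
rewrite detP_rec //; have -> : 2 ^+ n.+1 * B = 2 ^+ n * B + 2 ^+ n * B by rewrite exprS; ring.
have zI' : in_upper_half (fun i => z (lift ord0 i)) by move=> i; apply: zI.
have zinj' : injective (fun i => z (lift ord0 i)) by move=> i j /zinj /lift_inj.
apply: le_trans (ler_normD _ _) _; apply: lerD.
  apply: IH => // b.
  by rewrite -(subset_weight_false (fun i => `|w i * w' i|)).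
set c := _ * cauchy_mx z _ _.
(* The induction bound will be divided by |c|. For c = 0 the term vanishes, and B >= 0 because the
   empty subset has weight 1. *)
have [c0|c0] := eqVneq c 0.
  rewrite c0 mul0r normr0 mulr_ge0 ?exprn_ge0 //.
  by apply: le_trans (hB (fun=> false)); rewrite /subset_weight big_pred0_eq.
have cn : 0 < `|c| by rewrite normr_gt0.
rewrite normrM -ler_pdivlMl // mulrC -mulrA; apply: IH => // b.
rewrite ler_pdivlMr // mulrC.
apply: le_trans (hB (bcons true b)).
rewrite (subset_weight_true (fun i => `|w i * w' i|)) //.
rewrite /c normrM (ger0_norm (ltW (cauchy00_gt0 zI))).
rewrite ler_wpM2l //; first by rewrite mulr_ge0 // ltW // cauchy00_gt0.
rewrite /subset_weight; rewrite le_eqVlt; apply/orP; left; apply/eqP; apply: eq_bigr => i _; congr (_ * _).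
move: (blaschke _ _) => e; rewrite !normrM norm_conjC; ring.
Qed.

End CauchyMatrix.

(** * Sectors and arguments in the complex plane *)

Lemma ReD (a b : R[i]) : Re (a + b)%R = Re a + Re b. Proof. by case: a b => ? ? []. Qed.
Lemma ImD (a b : R[i]) : Im (a + b)%R = Im a + Im b. Proof. by case: a b => ? ? []. Qed.
Lemma ReM (a b : R[i]) : Re (a * b)%R = Re a * Re b - Im a * Im b.
Proof. by case: a b => ? ? []. Qed.
Lemma ImM (a b : R[i]) : Im (a * b)%R = Re a * Im b + Im a * Re b.
Proof. by case: a b => ? ? []. Qed.
Lemma ReN (a : R[i]) : Re (- a)%R = - Re a. Proof. by case: a. Qed.
Lemma ImN (a : R[i]) : Im (- a)%R = - Im a. Proof. by case: a. Qed.
Lemma ReV (a : R[i]) : Re (a^-1)%R = Re a / (Re a ^ 2 + Im a ^ 2).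
Proof. by case: a => p q /=; rewrite !Rmult_1_r. Qed.
Lemma ImV (a : R[i]) : Im (a^-1)%R = - (Im a / (Re a ^ 2 + Im a ^ 2)).
Proof. by case: a => p q /=; rewrite !Rmult_1_r. Qed.

Lemma Re0 : Re (0%R : R[i]) = 0. Proof. by []. Qed.
Lemma Im0 : Im (0%R : R[i]) = 0. Proof. by []. Qed.
Lemma Re1 : Re (1%R : R[i]) = 1. Proof. by []. Qed.
Lemma Im1 : Im (1%R : R[i]) = 0. Proof. by []. Qed.

Lemma complex_eq (a b : R[i]) : Re a = Re b -> Im a = Im b -> a = b.
Proof. by case: a b => ? ? [? ?] /= -> ->. Qed.

Lemma complex_eq0 (a : R[i]) : a <> RtoC 0 -> 0 < Re a ^ 2 + Im a ^ 2.
Proof.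
move=> h; have [//|h0] := Rlt_le_dec 0 (Re a ^ 2 + Im a ^ 2).
case: h; apply: complex_eq => /=; nra.
Qed.

Lemma norm_cabs (z : R[i]) : (`|z|)%R = RtoC (cabs z).
Proof. by rewrite normc_def /cabs RsqrtE !RpowE. Qed.

Lemma RtoC_inj a b : RtoC a = RtoC b -> a = b.
Proof. by case. Qed.

Lemma RtoCM a b : RtoC (a * b) = (RtoC a * RtoC b)%R.
Proof. by apply: complex_eq; rewrite ?ReM ?ImM /=; ring. Qed.

Lemma RtoC_le a b : (RtoC a <= RtoC b)%R -> a <= b.
Proof. by rewrite lecR => /RleP. Qed.

Lemma le_RtoC a b : a <= b -> (RtoC a <= RtoC b)%R.
Proof. by move=> /RleP; rewrite lecR. Qed.

Lemma cabsM a b : cabs (a * b)%R = cabs a * cabs b.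
Proof. by apply: RtoC_inj; rewrite RtoCM -!norm_cabs Num.Theory.normrM. Qed.

Lemma cabs_ge0 a : 0 <= cabs a.
Proof. exact: sqrt_pos. Qed.

Lemma cabs_sqr a : cabs a * cabs a = Re a ^ 2 + Im a ^ 2.
Proof. by rewrite /cabs sqrt_sqrt //; nra. Qed.

(** Convertible with the equation imposed on the argument in the theorem. *)
Definition polar (z : R[i]) (p : R) : Prop :=
  z = Complex (cabs z * cos p) (cabs z * sin p).

Lemma polar_mul a b p q : polar a p -> polar b q -> polar (a * b)%R (p + q).
Proof.
rewrite /polar cabsM; move: (cabs a) (cabs b) => r s -> ->.
by rewrite cos_plus sin_plus; apply: complex_eq; rewrite ?ReM ?ImM /=; ring.
Qed.

Lemma cabs_polar r p : 0 <= r -> cabs (Complex (r * cos p) (r * sin p)) = r.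
Proof.
move=> r0; rewrite /cabs /=.
have -> : r * cos p * (r * cos p * 1) + r * sin p * (r * sin p * 1) = r * r * (Rsqr (sin p) + Rsqr (cos p)).
  by rewrite /Rsqr; ring.
by rewrite sin2_cos2 Rmult_1_r sqrt_square.
Qed.

(** [rot_re] and [rot_im] are the real and imaginary parts of s exp (i th / 2). *)
Definition rot_re th (s : R[i]) := Re s * cos (th / 2) - Im s * sin (th / 2).
Definition rot_im th (s : R[i]) := Re s * sin (th / 2) + Im s * cos (th / 2).

(* The closed sector with apex 0 between the directions of [1] and [exp (- i th)], of either orientation, in coordinates rotated so that its axis is the positive real axis. *)
Definition sector th (s : R[i]) : Prop :=
  0 <= rot_re th s /\ Rabs (rot_im th s) <= tan (Rabs th / 2) * rot_re th s.

Section Sector.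
Variable th : R.
Hypothesis thpi : Rabs th < PI.

Lemma half_cos_gt0 : 0 < cos (Rabs th / 2).
Proof. by have := Rabs_pos th; move=> h; apply: cos_gt_0; have := PI_RGT_0; lra. Qed.

Lemma half_tan_ge0 : 0 <= tan (Rabs th / 2).
Proof.
rewrite /tan; apply: Rmult_le_pos; last exact: Rlt_le (Rinv_0_lt_compat _ half_cos_gt0).
by apply: sin_ge_0; have := Rabs_pos th; have := PI_RGT_0; lra.
Qed.

Lemma sectorD a b : sector th a -> sector th b -> sector th (a + b)%R.
Proof.
have T := half_tan_ge0.
rewrite /sector /rot_re /rot_im ReD ImD => -[a0 a1] [b0 b1]; split; first by lra.
set X := (X in Rabs X).
have -> : X = (Re a * sin (th / 2) + Im a * cos (th / 2)) + (Re b * sin (th / 2) + Im b * cos (th / 2)).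
  by rewrite /X; ring.
apply: Rle_trans (Rabs_triang _ _) _; lra.
Qed.

Lemma sectorZ (t a : R[i]) : (0 <= t)%R -> sector th a -> sector th (t * a)%R.
Proof.
move=> t0; have : Im t = 0 /\ 0 <= Re t.
  by move: t0; rewrite lecE /= => /andP [/eqP -> /RleP].
move=> [ti tr].
rewrite /sector /rot_re /rot_im ReM ImM ti => -[a0 a1]; split; first by nra.
set X := (X in Rabs X).
have -> : X = Re t * (Re a * sin (th / 2) + Im a * cos (th / 2)).
  by rewrite /X; ring.
rewrite Rabs_mult (Rabs_pos_eq _ tr).
move: a1; set u := Rabs _; set v := tan _ => a1; nra.
Qed.

Lemma rot_eq0 (a : R[i]) : rot_re th a = 0 -> rot_im th a = 0 -> a = RtoC 0.
Proof.
rewrite /rot_re /rot_im => h1 h2.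
have cs := sin2_cos2 (th / 2); rewrite /Rsqr in cs.
have E1 : Re a = (Re a * cos (th / 2) - Im a * sin (th / 2)) * cos (th / 2)
   + (Re a * sin (th / 2) + Im a * cos (th / 2)) * sin (th / 2).
  by rewrite -[LHS]Rmult_1_r -cs; ring.
have E2 : Im a = (Re a * sin (th / 2) + Im a * cos (th / 2)) * cos (th / 2)
   - (Re a * cos (th / 2) - Im a * sin (th / 2)) * sin (th / 2).
  by rewrite -[LHS]Rmult_1_r -cs; ring.
rewrite h1 h2 in E1; rewrite h1 h2 in E2.
by apply: complex_eq => /=; [rewrite E1|rewrite E2]; ring.
Qed.

Lemma sector_re0 a : sector th a -> rot_re th a = 0 -> a = RtoC 0.
Proof.
move=> [a0 a1] h; apply: rot_eq0 => //.
move: a1; rewrite h Rmult_0_r => a1.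
have := Rabs_pos (rot_im th a) => a2.
have : Rabs (rot_im th a) = 0 by lra.
exact: Rabs_eq_0.
Qed.

Lemma sector_pointed a b : sector th a -> sector th b -> (a + b = 0)%R -> (a = 0)%R.
Proof.
move=> Ka Kb ab; apply: sector_re0 => //.
have : rot_re th (a + b)%R = 0 by rewrite ab /rot_re Re0 Im0; ring.
rewrite /rot_re ReD ImD; case: Ka Kb => [a0 _] [b0 _]; rewrite /rot_re in a0 b0 *; lra.

Qed.

(** 1 is a boundary point, so the inequality is the equality |sin (th / 2)| = tan (|th| / 2) cos (th
    / 2). *)
Lemma sector1 : sector th 1%R.
Proof.
have c0 := half_cos_gt0.
rewrite /sector /rot_re /rot_im Re1 Im1 !Rmult_0_l !Rmult_1_l Rminus_0_r Rplus_0_r.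
have E : cos (th / 2) = cos (Rabs th / 2).
  by rewrite /Rabs; case: Rcase_abs => // _; rewrite -cos_neg; congr cos; field.
rewrite E; split; first exact: Rlt_le.
have -> : tan (Rabs th / 2) * cos (Rabs th / 2) = sin (Rabs th / 2).
  by rewrite /tan; field; lra.
rewrite {1}/Rabs; case: Rcase_abs => h; rewrite {1}/Rabs; case: Rcase_abs => h'; try lra.
- rewrite -sin_neg; have := Rle_refl (sin (- (th / 2))); congr (_ <= sin _); field.
- have : 0 <= sin (th / 2) by apply: sin_ge_0; have := Rle_abs th; have := PI_RGT_0; lra.
  lra.
- have : 0 <= sin (- (th / 2)).
    apply: sin_ge_0; first lra; have := Rle_abs (- th); rewrite Rabs_Ropp; have := PI_RGT_0; lra.
  have -> : - th / 2 = - (th / 2) by field. rewrite sin_neg; lra.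
Qed.

Lemma sector_polar s : sector th s -> s <> RtoC 0 -> exists r f,
  0 < r /\ (0 <= th -> 0 <= f <= th) /\ (th <= 0 -> th <= f <= 0) /\
  s = Complex (r * cos (- f)) (r * sin (- f)).
Proof.
move=> Ks s0; have r0 : 0 < rot_re th s.
  by case: (Ks) => [[//|h] _]; case: s0; apply: sector_re0.
have [_ h] := Ks.
(* [al] is the angle of s after the rotation by th / 2, so s has angle al - th / 2 and f = th / 2 -
   al. *)
pose al := atan (rot_im th s / rot_re th s).
have tal : rot_im th s = rot_re th s * tan al by rewrite /al tan_atan; field; lra.
have [al1 al2] := atan_bound (rot_im th s / rot_re th s); rewrite -/al in al1 al2.
have cal : 0 < cos al by apply: cos_gt_0; lra.
have ab : Rabs al <= Rabs th / 2.
  have hh : Rabs (tan al) <= tan (Rabs th / 2).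
    have -> : Rabs (tan al) = Rabs (rot_im th s) / rot_re th s.
      by rewrite tal Rabs_mult (Rabs_pos_eq (rot_re th s)); [field; lra|lra].
    by apply/Rle_div_l.
  have th2 : - (PI / 2) < Rabs th / 2 < PI / 2 by have := Rabs_pos th; lra.
  have [//|c] := Rle_lt_dec (Rabs al) (Rabs th / 2).
  have : tan (Rabs th / 2) < tan (Rabs al).
    have a1' : - (PI / 2) < al by lra.
    by have := Rabs_def1 al (PI / 2) al2 a1'; have := Rabs_pos th => ? ?; apply: tan_increasing; lra.
  have -> : tan (Rabs al) = Rabs (tan al).
    rewrite {1}/Rabs; case: Rcase_abs => hal.
      by rewrite tan_neg Rabs_left //; have := tan_increasing al 0; rewrite tan_0; apply; lra.
    rewrite Rabs_pos_eq //.
    have [al0|->] : 0 < al \/ al = 0 by lra.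
      by have := tan_increasing 0 al; rewrite tan_0 => /(_ _ _ _)/Rlt_le; apply; lra.
    by rewrite tan_0; lra.
  lra.
exists (rot_re th s / cos al), (th / 2 - al); split; first exact: Rdiv_lt_0_compat.
move: ab; rewrite /Rabs; case: Rcase_abs => ?; case: Rcase_abs => ? ab.
all: split; [lra|split; [lra|]].
all: have cs := sin2_cos2 (th / 2); rewrite /Rsqr in cs.
all: have -> : - (th / 2 - al) = al - th / 2 by ring.
all: rewrite cos_minus sin_minus.
all: have tc : sin al = cos al * tan al by rewrite /tan; field; lra.
all: apply: complex_eq; rewrite /= tc.
all: try (transitivity (rot_re th s * cos (th / 2) + rot_re th s * tan al * sin (th / 2)); last (by field; lra);
   by rewrite -tal /rot_re /rot_im -[LHS]Rmult_1_r -cs; ring).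
all: transitivity (rot_re th s * tan al * cos (th / 2) - rot_re th s * sin (th / 2)); last (by field; lra).
all: by rewrite -tal /rot_re /rot_im -[LHS]Rmult_1_r -cs; ring.
Qed.

End Sector.

Lemma sector_cis th r f : Rabs th < PI -> 0 < r ->
  (0 <= th -> 0 <= f <= th) -> (th <= 0 -> th <= f <= 0) ->
  sector th (Complex (r * cos (- f)) (r * sin (- f))).
Proof.
move=> thpi r0 f1 f2.
have c0 := half_cos_gt0 _ thpi.
rewrite /sector /rot_re /rot_im /=.
have -> : r * cos (- f) * cos (th / 2) - r * sin (- f) * sin (th / 2) = r * cos (th / 2 - f).
  by rewrite (_ : th / 2 - f = - f + th / 2); [rewrite cos_plus; ring|ring].
have -> : r * cos (- f) * sin (th / 2) + r * sin (- f) * cos (th / 2) = r * sin (th / 2 - f).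
  by rewrite (_ : th / 2 - f = - f + th / 2); [rewrite sin_plus; ring|ring].
set al := th / 2 - f.
have ab : Rabs al <= Rabs th / 2.
  by rewrite /al /Rabs; case: Rcase_abs => ?; case: Rcase_abs => ?; lra.
have abp := Rabs_pos al.
have Eal : cos al = cos (Rabs al) by rewrite /Rabs; case: Rcase_abs => // _; rewrite cos_neg.
have cal : 0 < cos al by rewrite Eal; apply: cos_gt_0; lra.
split; first by apply: Rmult_le_pos; lra.
rewrite Rabs_mult (Rabs_pos_eq r); last lra.
have -> : Rabs (sin al) = sin (Rabs al).
  rewrite {2}/Rabs; case: Rcase_abs => hal.
    have : 0 <= sin (- al) by apply: sin_ge_0; have := Rabs_left _ hal; lra.
    by rewrite sin_neg => ?; rewrite Rabs_left1 //; lra.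
  by rewrite Rabs_pos_eq //; apply: sin_ge_0; have := Rabs_pos_eq al; lra.
(* The boundary of the sector is treated apart because [tan_increasing] is strict. *)
have [e|l] : Rabs al = Rabs th / 2 \/ Rabs al < Rabs th / 2 by lra.
  by rewrite Eal e /tan; right; field; lra.
have h : tan (Rabs al) < tan (Rabs th / 2) by apply: tan_increasing; lra.
have -> : sin (Rabs al) = tan (Rabs al) * cos al by rewrite Eal /tan; field; rewrite -Eal; lra.
have p0 : 0 < r * cos al by apply: Rmult_lt_0_compat.
have := Rmult_lt_compat_r _ _ _ p0 h; lra.
Qed.

(** The half-angle formula tan (arg / 2) = Im s / (|s| + Re s). Off the nonpositive real axis it is
    the principal argument in closed form, so continuity can be read off, unlike for [Arg], which is
    chosen by [epsilon]. *)
Definition argc (s : R[i]) : R := 2 * atan (Im s / (cabs s + Re s)).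

Lemma argc_polar r f : 0 < r -> Rabs f < PI ->
  0 < cabs (Complex (r * cos f) (r * sin f)) + r * cos f /\
  argc (Complex (r * cos f) (r * sin f)) = f.
Proof.
move=> r0 /Rabs_def2 [f1 f2].
have c0 : 0 < cos (f / 2) by apply: cos_gt_0; lra.
rewrite /argc cabs_polar /=; last lra.
have E : r + r * cos f = 2 * r * (cos (f / 2) * cos (f / 2)).
  have {1}-> : f = 2 * (f / 2) by field.
  rewrite cos_2a_cos; ring.
have S : r * sin f = 2 * r * (sin (f / 2) * cos (f / 2)).
  have {1}-> : f = 2 * (f / 2) by field.
  by rewrite sin_2a; ring.
split; first by rewrite E; apply: Rmult_lt_0_compat; nra.
rewrite S E.
have -> : 2 * r * (sin (f / 2) * cos (f / 2)) / (2 * r * (cos (f / 2) * cos (f / 2))) = tan (f / 2).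
  by rewrite /tan; field; lra.
by rewrite atan_tan; [field|lra].
Qed.

Lemma sector_argc th s : Rabs th < PI -> sector th s -> s <> RtoC 0 ->
  0 < cabs s + Re s /\ polar s (argc s) /\
  (0 <= th -> - th <= argc s <= 0) /\ (th <= 0 -> 0 <= argc s <= - th).
Proof.
move=> thpi Ks s0; have [r [f [r0 [f1 [f2 ->]]]]] := sector_polar _ thpi _ Ks s0.
have fpi : Rabs (- f) < PI.
  by move: thpi; rewrite /Rabs; case: Rcase_abs => ?; case: Rcase_abs => ?; lra.
have [h ->] := argc_polar r _ r0 fpi.
split; first exact: h.
split; last by lra.
by rewrite /polar cabs_polar //; lra.
Qed.

(** For mu = r exp (- i f), |1 + mu|^2 = 1 + 2 r cos f + r^2 = (r + cos f)^2 + sin^2 f. This is at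
    least 1 if cos f >= 0, and otherwise at least sin^2 f >= sin^2 th, as sin decreases on
    [pi/2, pi]. *)
Lemma sector_add1 th mu : Rabs th < PI -> sector th mu -> dfun (Rabs th) <= cabs (1 + mu)%R.
Proof.
move=> thpi Ks.
have d1 : dfun (Rabs th) <= 1.
  by rewrite /dfun; case: Rle_dec => ? /=; [lra|have := SIN_bound (Rabs th); lra].
have cb (b : R[i]) d : d <= 1 -> (d <= 0 \/ d * d <= Re b ^ 2 + Im b ^ 2) -> d <= cabs b.
  move=> _ [d0|d0]; first exact: Rle_trans d0 (cabs_ge0 _).
  by apply: Rsqr_incr_0_var (cabs_ge0 _); rewrite /Rsqr cabs_sqr.
case: (Req_EM_T (rot_re th mu) 0) => [h|h].
  rewrite (sector_re0 _ _ Ks h); apply: cb => //; right; rewrite ReD ImD Re1 Im1 /=.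
  have : -1 <= dfun (Rabs th).
    by rewrite /dfun; case: Rle_dec => ? /=; [lra|have := SIN_bound (Rabs th); lra].
  nra.
have mu0 : mu <> RtoC 0 by move=> e; apply: h; rewrite e /rot_re [Re _]/= [Im _]/=; ring.
have [r [f [r0 [f1 [f2 ->]]]]] := sector_polar _ thpi _ Ks mu0.
have cs := sin2_cos2 (- f); rewrite /Rsqr in cs.
apply: cb => //; right; rewrite ReD ImD Re1 Im1 /=.
have -> : (1 + r * cos (- f)) * ((1 + r * cos (- f)) * 1) + (0 + r * sin (- f)) * ((0 + r * sin (- f)) * 1)
   = 1 + 2 * r * cos (- f) + r * r * (sin (- f) * sin (- f) + cos (- f) * cos (- f)) by ring.
rewrite cs.
have fth : Rabs f <= Rabs th by rewrite /Rabs; case: Rcase_abs => ?; case: Rcase_abs => ?; lra.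
rewrite /dfun; case: Rle_dec => hth /=.
  have /Rabs_le_between fb : Rabs f <= PI / 2 by lra.
  have : 0 <= cos (- f) by apply: cos_ge_0; lra.
  nra.
have s0 : 0 <= sin (Rabs th) by apply: sin_ge_0; have := PI_RGT_0; lra.
have [c|c] := Rle_lt_dec 0 (cos (- f)).
  have := SIN_bound (Rabs th); nra.
have : sin (Rabs th) <= Rabs (sin (- f)).
  have fgt : PI / 2 < Rabs f.
    have [/Rabs_le_between hf|//] := Rle_lt_dec (Rabs f) (PI / 2).
    have : 0 <= cos (- f) by apply: cos_ge_0; lra.
    lra.
  have -> : Rabs (sin (- f)) = sin (Rabs f).
    have sf : 0 <= sin (Rabs f) by apply: sin_ge_0; lra.
    rewrite -(Rabs_pos_eq _ sf) sin_neg Rabs_Ropp.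
    have [hf|hf] := Rcase_abs f; first by rewrite (Rabs_left f) // sin_neg Rabs_Ropp.
    by rewrite (Rabs_pos_eq f) //; lra.
  by apply: sin_decr_1; have := PI_RGT_0; lra.
have : Rabs (sin (- f)) * Rabs (sin (- f)) = sin (- f) * sin (- f).
  by rewrite -Rabs_mult Rabs_pos_eq //; nra.
have := Rle_0_sqr (r + cos (- f)); rewrite /Rsqr.
have := Rabs_pos (sin (- f)).
nra.
Qed.

(** * Continuous arguments of determinants *)

Definition ccont (f : R * R -> R[i]) (p : R * R) : Prop :=
  continuous (fun q => Re (f q)) p /\ continuous (fun q => Im (f q)) p.

Lemma ccont_ext f g p : (forall q, f q = g q) -> ccont f p -> ccont g p.
Proof.
move=> fg [h1 h2]; split.
  by apply: continuous_ext h1 => q; rewrite fg.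
by apply: continuous_ext h2 => q; rewrite fg.
Qed.

Lemma ccont_const c p : ccont (fun=> c) p.
Proof. by split; apply: continuous_const. Qed.

Lemma ccontD f g p : ccont f p -> ccont g p -> ccont (fun q => f q + g q)%R p.
Proof.
move=> [f1 f2] [g1 g2]; split.
  apply: (continuous_ext (fun q => plus (Re (f q)) (Re (g q)))); last exact: continuous_plus.
  by move=> q; rewrite ReD.
apply: (continuous_ext (fun q => plus (Im (f q)) (Im (g q)))); last exact: continuous_plus.
by move=> q; rewrite ImD.
Qed.

Lemma ccontM f g p : ccont f p -> ccont g p -> ccont (fun q => f q * g q)%R p.
Proof.
move=> [f1 f2] [g1 g2]; split.
  apply: (continuous_ext (fun q => minus (mult (Re (f q)) (Re (g q))) (mult (Im (f q)) (Im (g q))))).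
    by move=> q; rewrite ReM.
  by apply: continuous_minus; apply: continuous_mult.
apply: (continuous_ext (fun q => plus (mult (Re (f q)) (Im (g q))) (mult (Im (f q)) (Re (g q))))).
  by move=> q; rewrite ImM.
by apply: continuous_plus; apply: continuous_mult.
Qed.

Lemma continuous_Rdiv (f g : R * R -> R) p : g p <> 0 ->
  continuous f p -> continuous g p -> continuous (fun q => f q / g q) p.
Proof.
move=> g0 cf cg; apply: (continuous_mult f (fun q => / g q)) => //.
apply: (continuous_comp g Rinv) => //; apply/continuity_pt_filterlim.
by apply: (continuity_pt_inv id) => //; apply: continuity_pt_id.
Qed.

Lemma ccontV f p : f p <> RtoC 0 -> ccont f p -> ccont (fun q => (f q)^-1)%R p.
Proof.
move=> /complex_eq0 f0 [f1 f2].
have cn : continuous (fun q => Re (f q) ^ 2 + Im (f q) ^ 2) p.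
  apply: (continuous_plus (fun q => Re (f q) ^ 2) (fun q => Im (f q) ^ 2)) => /=.
    by apply: (continuous_mult (fun q => Re (f q)) (fun q => Re (f q) * 1)) => //;
       apply: (continuous_mult (fun q => Re (f q)) (fun q => 1)) => //; apply: continuous_const.
  by apply: (continuous_mult (fun q => Im (f q)) (fun q => Im (f q) * 1)) => //;
     apply: (continuous_mult (fun q => Im (f q)) (fun q => 1)) => //; apply: continuous_const.
split.
  apply: continuous_ext => [q|]; first by rewrite ReV.
  by apply: continuous_Rdiv => //; lra.
apply: continuous_ext => [q|]; first by rewrite ImV.
apply: (continuous_opp (fun q => Im (f q) / (Re (f q) ^ 2 + Im (f q) ^ 2))).
by apply: continuous_Rdiv => //; lra.
Qed.

Lemma ccont_sum (I : Type) (s : seq I) (P : pred I) (F : I -> R * R -> R[i]) p :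
  (forall i, ccont (F i) p) -> ccont (fun q => \sum_(i <- s | P i) F i q)%R p.
Proof.
move=> hF; elim: s => [|i s IH].
  by apply: ccont_ext (ccont_const 0%R p) => q; rewrite big_nil.
case Pi : (P i); last by apply: ccont_ext IH => q; rewrite big_cons Pi.
by apply: ccont_ext (ccontD _ _ _ (hF i) IH) => q; rewrite big_cons Pi.
Qed.

Lemma ccont_prod (I : Type) (s : seq I) (P : pred I) (F : I -> R * R -> R[i]) p :
  (forall i, ccont (F i) p) -> ccont (fun q => \prod_(i <- s | P i) F i q)%R p.
Proof.
move=> hF; elim: s => [|i s IH].
  by apply: ccont_ext (ccont_const 1%R p) => q; rewrite big_nil.
case Pi : (P i); last by apply: ccont_ext IH => q; rewrite big_cons Pi.
by apply: ccont_ext (ccontM _ _ _ (hF i) IH) => q; rewrite big_cons Pi.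
Qed.

Lemma ccont_det n (M : R * R -> 'M[R[i]]_n) p :
  (forall i j, ccont (fun q => M q i j) p) -> ccont (fun q => \det (M q))%R p.
Proof.
move=> hM; rewrite /determinant; apply: ccont_sum => s.
by apply: ccontM; [apply: ccont_const|apply: ccont_prod => i].
Qed.

Lemma continuous_argc f p : ccont f p -> 0 < cabs (f p) + Re (f p) ->
  continuous (fun q => argc (f q)) p.
Proof.
move=> [f1 f2] h; rewrite /argc.
apply: (continuous_mult (fun=> 2)); first exact: continuous_const.
apply: (continuous_comp _ atan).
  apply: continuous_Rdiv => //; first lra.
  apply: (continuous_plus (fun q => cabs (f q)) (fun q => Re (f q))) => //.
  apply: (continuous_comp (fun q => Re (f q) ^ 2 + Im (f q) ^ 2) sqrt); last first.
    by apply/continuity_pt_filterlim; apply: continuity_pt_sqrt; nra.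
  apply: (continuous_plus (fun q => Re (f q) ^ 2) (fun q => Im (f q) ^ 2)) => /=.
    by apply: (continuous_mult (fun q => Re (f q)) (fun q => Re (f q) * 1)) => //;
       apply: (continuous_mult (fun q => Re (f q)) (fun q => 1)) => //; apply: continuous_const.
  by apply: (continuous_mult (fun q => Im (f q)) (fun q => Im (f q) * 1)) => //;
     apply: (continuous_mult (fun q => Im (f q)) (fun q => 1)) => //; apply: continuous_const.
by apply/continuity_pt_filterlim; apply: derivable_continuous_pt; apply: derivable_pt_atan.
Qed.

(* The argument is built one row at a time: the ratio of two successive minors stays in the sector, where the principal argument is continuous and of one sign. *)
Lemma exists_arg_det_add_diag c h n (G : 'M[R[i]]_n) (w : R * R -> 'I_n -> R[i]) :
  (forall y, Rabs y <= h -> Rabs (c * y) < PI) ->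
  psd G ->
  (forall x y i, Rabs y <= h -> sector (c * y) (w (x, y) i) /\ w (x, y) i <> RtoC 0) ->
  (forall p i, ccont (fun q => w q i) p) ->
  exists phi : R * R -> R, forall x y : R, Rabs y <= h ->
    [/\ continuous phi (x, y),
        polar (\det (G + diag_mx (\row_i w (x, y) i)))%R (phi (x, y)),
        0 <= c * y -> - (INR n * (c * y)) <= phi (x, y) <= 0
      & c * y <= 0 -> 0 <= phi (x, y) <= - (INR n * (c * y))].
Proof.
elim: n G w => [|n IH] G w hc Gpsd Kw cw.
  exists (fun=> 0) => x y yh; split.
  - exact: continuous_const.
  - rewrite det_mx00 /polar cos_0 sin_0.
    have -> : cabs 1%R = 1 by rewrite /cabs Re1 Im1 -[RHS]sqrt_1; congr sqrt; ring.
    by rewrite Rmult_1_r Rmult_0_r.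
  - by rewrite /= Rmult_0_l; lra.
  - by rewrite /= Rmult_0_l; lra.
pose w' q i := w q (lift ord0 i).
have [phi hphi] := IH (row' ord0 (col' ord0 G)) w' hc (psd_minor Gpsd)
  (fun x y i => Kw x y (lift ord0 i)) (fun p i => cw p (lift ord0 i)).
pose B q := (G + diag_mx (\row_i w q i))%R.
pose B' q := (row' ord0 (col' ord0 G) + diag_mx (\row_i w' q i))%R.
(* The minor has the same form G + W one size down, so the induction hypothesis supplies its
   argument. *)
have BE q : row' ord0 (col' ord0 (B q)) = B' q.
  by apply/matrixP => i j; rewrite !mxE (inj_eq lift_inj).
pose s q := (\det (B q) / \det (B' q))%R.
exists (fun q => phi q + argc (s q)) => x y yh.
have [ph1 ph2 ph3 ph4] := hphi x y yh.
have thpi := hc y yh.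
have K1 := sector1 _ thpi.
have KD := sectorD _ thpi.
have KZ := sectorZ (c * y).
have Kp := sector_pointed (c * y).
have Kw1 i := proj1 (Kw x y i yh).
have w0 i : w (x, y) i != 0%R by apply/eqP; apply: (proj2 (Kw x y i yh)).
have B0 : (\det (B (x, y)) != 0)%R by apply: (det_add_diag_neq0 K1 KD KZ Kp).
have B'0 : (\det (B' (x, y)) != 0)%R.
  by apply: (det_add_diag_neq0 K1 KD KZ Kp) => // [|i|i]; [apply: psd_minor|apply: Kw1|apply: w0].
have Ks : sector (c * y) (s (x, y)).
  by rewrite /s -BE; exact: (minor_ratio_cone K1 KD KZ Kp Gpsd Kw1 w0).
have s0 : s (x, y) <> RtoC 0.
  by apply/eqP; rewrite GRing.mulf_neq0 // GRing.invr_eq0.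
have [s1 [s2 [s3 s4]]] := sector_argc _ _ thpi Ks s0.
have cdet m (G' : 'M[R[i]]_m) (u : R * R -> 'I_m -> R[i]) p : (forall i, ccont (fun q => u q i) p) ->
    ccont (fun q => \det (G' + diag_mx (\row_i u q i)))%R p.
  move=> hu; apply: ccont_det => i j.
  apply: (ccont_ext (fun q => G' i j + (if i == j then u q i else 0))%R) => [q|].
    by rewrite !mxE; case: eqVneq => [->|_]; rewrite ?GRing.mulr1n ?GRing.mulr0n.
  apply: ccontD; first exact: ccont_const.
  by case: (i == j) => //; apply: ccont_const.
split.
- apply: (continuous_plus phi) => //.
  apply: continuous_argc => //.
  apply: ccontM; first by apply: cdet => i; apply: cw.
  apply: ccontV; first exact/eqP.
  by apply: cdet => i; apply: cw.
- have -> : (\det (G + diag_mx (\row_i w (x, y) i)) = \det (B' (x, y)) * s (x, y))%R.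
    by rewrite /s GRing.mulrCA GRing.mulfV // GRing.mulr1.
  exact: polar_mul.
- by rewrite S_INR => h0; have := ph3 h0; have := s3 h0; lra.
- by rewrite S_INR => h0; have := ph4 h0; have := s4 h0; lra.
Qed.

(** Equality mod 2 pi is expressed by the cosine, the form in which [continuous_cos_eq1] uses it. *)
Lemma polar_unique (z : R[i]) p q : z <> RtoC 0 -> polar z p -> polar z q -> cos (p - q) = 1.
Proof.
move=> z0 hp hq.
have c0 : cabs z <> 0.
  by have := complex_eq0 _ z0; rewrite -cabs_sqr => h e; move: h; rewrite e; lra.
have : Complex (cabs z * cos q) (cabs z * sin q) = Complex (cabs z * cos p) (cabs z * sin p).
  by rewrite -[LHS]hq.
case=> e1 e2.
have h1 := Rmult_eq_reg_l _ _ _ e1 c0; have h2 := Rmult_eq_reg_l _ _ _ e2 c0.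
by rewrite cos_minus -h1 -h2; have := sin2_cos2 q; rewrite /Rsqr; lra.
Qed.

Lemma continuous_cos_eq1 (f : R -> R) (a : R) : continuity f -> f 0 = 0 ->
  (forall s, 0 <= s <= a -> cos (f s) = 1) -> 0 <= a -> f a = 0.
Proof.
move=> cf f0 hf a0.
have key g : continuity g -> g 0 = 0 -> (forall s, 0 <= s <= a -> cos (g s) = 1) -> ~ 0 < g a.
  move=> cg g0 hg ga.
  have apos : 0 < a by case: a0 => // a00; move: ga; rewrite -a00 g0; lra.
  have pi0 := PI_RGT_0.
  (* m lies in (0, pi], where cos < 1, and below g a, so g takes the value m on the way. *)
  pose m := Rmin (g a / 2) PI.
  have m0 : 0 < m by apply: Rmin_pos; lra.
  have m1 := Rmin_l (g a / 2) PI; have m2 := Rmin_r (g a / 2) PI; rewrite -/m in m1 m2.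
  have ch : continuity (fun s => g s - m).
    by apply: continuity_minus => //; apply: continuity_const => ? ?.
  have [s [s1 s2]] := IVT (fun s => g s - m) 0 a ch apos (ltac:(cbv beta; rewrite g0; lra)) (ltac:(cbv beta; lra)).
  have e : g s = m by lra.
  have := hg s s1; rewrite e => cm.
  have := cos_decreasing_1 0 m (Rle_refl 0) (Rlt_le _ _ pi0) (Rlt_le _ _ m0) m2 m0.
  by rewrite cos_0; lra.
have h1 := key f cf f0 hf.
have h2 : ~ 0 < - f a.
  apply: (key (fun s => - f s)).
  - exact: continuity_opp.
  - by rewrite f0; lra.
  - by move=> s hs; rewrite cos_neg; apply: hf.
lra.
Qed.

(** The theorem bounds every continuous argument; uniqueness transfers the bound from the
    constructed one. Along the vertical segment from the real axis, the difference of two arguments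
    is a continuous multiple of 2 pi that starts at 0. *)
Lemma strip_arg_unique h (Z : R -> R -> R[i]) (phi psi : R -> R -> R) :
  (forall x y, Rabs y <= h -> Z x y <> RtoC 0) ->
  continuous_on_strip h phi -> continuous_on_strip h psi ->
  (forall x, phi x 0 = 0) -> (forall x, psi x 0 = 0) ->
  (forall x y, Rabs y <= h -> polar (Z x y) (phi x y)) ->
  (forall x y, Rabs y <= h -> polar (Z x y) (psi x y)) ->
  forall x y, Rabs y <= h -> phi x y = psi x y.
Proof.
move=> Z0 cphi cpsi phi0 psi0 hphi hpsi x y yh.
(* Clamping to [0, 1] keeps the path s -> y cl(s) inside the strip for all real s, as [continuity]
   is a global notion. *)
pose cl s := Rmax 0 (Rmin 1 s).
have clP s : (s <= 0 /\ cl s = 0) \/ (0 <= s <= 1 /\ cl s = s) \/ (1 <= s /\ cl s = 1).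
  rewrite /cl; have [?|?] := Rle_lt_dec s 1.
    rewrite Rmin_right //; have [?|?] := Rle_lt_dec s 0; first by rewrite Rmax_left; lra.
    by rewrite Rmax_right; lra.
  by rewrite Rmin_left ?Rmax_right; lra.
have cl01 s : 0 <= cl s <= 1 by have := clP s; lra.
have cl_lip s s' : Rabs (cl s' - cl s) <= Rabs (s' - s).
  have := clP s; have := clP s'; have := Rabs_le_between (cl s' - cl s) (Rabs (s' - s)).
  have := Rle_abs (s' - s); have := Rle_abs (- (s' - s)); rewrite Rabs_Ropp.
  by move=> ? ? [_ k] ? ?; apply: k; lra.
have yc s : Rabs (y * cl s) <= h.
  rewrite Rabs_mult (Rabs_pos_eq (cl s)); last by have := cl01 s; lra.
  have := cl01 s; have := Rabs_pos y; nra.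
have cont (f : R -> R -> R) : continuous_on_strip h f -> continuity (fun s => f x (y * cl s)).
  move=> cf s e e0; have [d [d0 hd]] := cf x (y * cl s) (yc s) e e0.
  (* The + 1 keeps the divisor positive at y = 0. *)
  have y1 : 0 < Rabs y + 1 by have := Rabs_pos y; lra.
  exists (d / (Rabs y + 1)); split; first exact: Rdiv_lt_0_compat.
  move=> s' [_]; rewrite /= /Rdist => ss.
  apply: hd; first exact: yc.
    by rewrite Rminus_diag Rabs_R0.
  have -> : y * cl s' - y * cl s = y * (cl s' - cl s) by ring.
  rewrite Rabs_mult; move: ss => /(Rlt_div_r _ _ _ y1).
  have := cl_lip s s'; have := Rabs_pos y; have := Rabs_pos (cl s' - cl s); nra.
pose f s := phi x (y * cl s) - psi x (y * cl s).
have cl0 : cl 0 = 0 by have := clP 0; lra.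
have cl1 : cl 1 = 1 by have := clP 1; lra.
have : f 1 = 0.
  apply: continuous_cos_eq1; last lra.
  - by apply: continuity_minus; apply: cont.
  - by rewrite /f cl0 Rmult_0_r phi0 psi0; lra.
  - by move=> s _; apply: (polar_unique (Z x (y * cl s))); [apply: Z0|apply: hphi|apply: hpsi].
by rewrite /f cl1 Rmult_1_r; lra.
Qed.

(** * Estimates for Z in the strip *)

(** With u = v M^-1, the form of M at u is the conjugate of the form of M^-1 at v. *)
Lemma psd_invmx (F : Num.ClosedField.type) n (M : 'M[F]_n) :
  M \in unitmx -> psd M -> psd (invmx M).
Proof.
move=> Mu Mpsd v.
pose u j : F := (\sum_i v i * invmx M i j)%R.
have uM j : (\sum_i u i * M i j)%R = v j.
  transitivity (\sum_i \sum_k (v k * (invmx M k i * M i j)))%R.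
    by apply: eq_bigr => i _; rewrite /u GRing.mulr_suml; apply: eq_bigr => k _; rewrite GRing.mulrA.
  rewrite exchange_big /=.
  transitivity (\sum_k v k * (k == j)%:R)%R.
    apply: eq_bigr => k _; rewrite -GRing.mulr_sumr; congr (_ * _)%R.
    by have := congr1 (fun A : 'M_n => A k j) (mulVmx Mu); rewrite !mxE.
  rewrite (bigD1 j) //= big1 => [|k /negbTE->]; last by rewrite GRing.mulr0.
  by rewrite eqxx GRing.mulr1 GRing.addr0.
have E : hform M u = ((hform (invmx M) v)^*)%R.
  rewrite !hform_colsum GRing.rmorph_sum; apply: eq_bigr => j _.
  by rewrite uM GRing.rmorphM /= Num.Theory.conjCK GRing.mulrC.
by have := Mpsd u; rewrite E Num.Theory.conjC_ge0.
Qed.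

Lemma Im_complexE (z : R[i]) : @Num.Theory.Im R[i] z = RtoC (Im z).
Proof.
have -> : RtoC (Im z) = ((conjc z - z) / 2 * 'i%C)%R by rewrite -ImJ_sub.
by rewrite Num.Theory.ImE [X in (X / _)%R]GRing.mulrC GRing.mulrAC.
Qed.

Lemma conj_cconj (z : R[i]) : (z^*)%R = cconj z.
Proof. by case: z. Qed.

Lemma cexpD a b : cexp (a + b)%R = (cexp a * cexp b)%R.
Proof.
rewrite /cexp ReD ImD exp_plus cos_plus sin_plus.
by apply: complex_eq; rewrite ?ReM ?ImM /=; ring.
Qed.

Lemma cabs_gt0 (z : R[i]) : z <> RtoC 0 -> 0 < cabs z.
Proof. by move=> /complex_eq0 h; apply: sqrt_lt_R0. Qed.

Lemma cabsV (z : R[i]) : cabs (z^-1)%R = / cabs z.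
Proof.
have [->|/eqP z0] := eqVneq z 0%R.
  by rewrite GRing.invr0 /cabs Re0 Im0 /= Rmult_0_l Rplus_0_l sqrt_0 Rinv_0.
have h := cabs_gt0 _ z0.
apply: (Rmult_eq_reg_l (cabs z)); last lra.
rewrite -cabsM Rinv_r; last lra.
rewrite GRing.mulfV; last exact/eqP.
by rewrite /cabs Re1 Im1 -[RHS]sqrt_1; congr sqrt; ring.
Qed.

Lemma RtoCV a : a <> 0 -> RtoC (/ a) = (RtoC a)^-1%R.
Proof. by move=> a0; apply: complex_eq; rewrite ?ReV ?ImV /=; field. Qed.

Lemma coupling_gfun (z w : R[i]) : 0 < Im z -> 0 < Im w ->
  coupling z w = RtoC (exp (- gfun z w)).
Proof.
move=> z0 w0; rewrite /coupling /gfun conj_cconj.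
have nz (a b : R[i]) : 0 < Im a -> 0 < Im b -> (a - cconj b)%R <> RtoC 0.
  by move=> a0 b0 /(congr1 (@Im _)); rewrite ImD ImN /= => ?; lra.
have [zw|zw] := eqVneq z w.
  subst w; have c0 := cabs_gt0 _ (nz z z z0 z0).
  by rewrite norm_cabs exp_Ropp exp_ln // RtoCV //; lra.
have zw0 : (z - w)%R <> RtoC 0 by apply/eqP; rewrite GRing.subr_eq0.
rewrite conj_cconj norm_cabs exp_Ropp exp_ln; last first.
  apply: cabs_gt0; apply/eqP; rewrite GRing.mulf_neq0 ?GRing.invr_eq0; apply/eqP => //; exact: nz.
by rewrite -cabsV GRing.invf_div.
Qed.

Lemma bigmin_le (I : finType) (F : I -> R) x0 i :
  \big[Rmin/x0]_(j : I) F j <= F i.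
Proof.
have : i \in index_enum I by rewrite mem_index_enum.
elim: (index_enum I) => // j s IH; rewrite in_cons big_cons => /orP [/eqP->|/IH h].
  exact: Rmin_l.
exact: Rle_trans (Rmin_r _ _) h.
Qed.

Lemma prod_RtoC_exp (I : finType) (P : pred I) (F : I -> R) :
  (\prod_(i | P i) RtoC (exp (F i)))%R = RtoC (exp (\big[Rplus/0]_(i | P i) F i)).
Proof.
elim/big_rec2: _ => [|i a b _ ->]; first by rewrite exp_0.
by rewrite exp_plus RtoCM.
Qed.

Lemma bigRplus_lin (I : finType) (P : pred I) (F G : I -> R) a b :
  \big[Rplus/0]_(i | P i) (a * F i + b * G i) =
  a * \big[Rplus/0]_(i | P i) F i + b * \big[Rplus/0]_(i | P i) G i.
Proof. by elim/big_rec3: _ => [|i x y u _ ->]; ring. Qed.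

Lemma exp_nondecreasing x y : x <= y -> exp x <= exp y.
Proof. by case=> [/exp_increasing/Rlt_le|->]; last exact: Rle_refl. Qed.

Lemma pow_le_cabs_prod (s : seq R[i]) d : 0 <= d ->
  (forall mu, mu \in s -> d <= cabs mu) -> d ^ size s <= cabs (\prod_(mu <- s) mu)%R.
Proof.
move=> d0; elim: s => [|m s IH] h.
  by rewrite big_nil /cabs Re1 Im1 /= !Rmult_1_r Rmult_0_l Rplus_0_r sqrt_1; lra.
rewrite big_cons cabsM /=; apply: Rmult_le_compat => //; first exact: pow_le.
  by apply: h; rewrite mem_head.
by apply: IH => mu ms; apply: h; rewrite in_cons ms orbT.
Qed.

Lemma dfun_gt0 th : 0 <= th < PI -> 0 < dfun th.
Proof.
by move=> h; rewrite /dfun; case: Rle_dec => c /=; [lra|apply: sin_gt_0; have := PI_RGT_0; lra].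
Qed.

Section Strip.
Variables (delta : R) (u0 : R -> R) (xmax : R) (N : nat) (t : R).
Let eps := epsN delta u0 xmax N.
Let kmax := kappa_max delta u0 xmax.
Let kap (i : 'I_N) := kappa_n delta u0 xmax N i.+1.
Let Z := fun x y => ZN delta u0 xmax N (Complex x y) t.
Let z (i : 'I_N) := zeta_n delta u0 xmax N i.+1.
Hypotheses (delta0 : 0 < delta) (eps0 : 0 < eps) (kmax0 : 0 < kmax)
  (kmaxpi : 2 * delta * kmax < PI)
  (kap0 : forall i, 0 < kap i < kmax) (kap_inj : injective kap).

Let c := 2 * kmax / eps.
Let h := delta * eps.
Let tau (i : 'I_N) := Im ((z i - RtoC (/ (2 * delta))) ^+ 2)%R.
(** The modulus of the squared entry of D_N: theta_+ from [c_n] and the exponents of D_N combine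
    into -2 V / eps. The phase in [w] carries y. *)
Let P (i : 'I_N) (x : R) := exp (- (2 * Vk delta u0 xmax (kap i) x t) / eps).
Let w (q : R * R) (i : 'I_N) : R[i] :=
  Complex (P i q.1 * cos (- (2 * kap i * q.2 / eps))) (P i q.1 * sin (- (2 * kap i * q.2 / eps))).
Let d (q : R * R) (i : 'I_N) : R[i] :=
  (RtoC (sqrt (c_n delta u0 xmax N i.+1)) *
     cexp (- (RtoC (kap i / eps) * Complex q.1 q.2) - RtoC (tau i * t / eps)))%R.

(** This fixes the width of the strip: at |y| = delta eps the angle is 2 delta kappa_max, which is
    below pi. *)
Lemma strip_angle y : Rabs y <= h -> Rabs (c * y) < PI.
Proof.
move=> yh; rewrite /c Rabs_mult Rabs_pos_eq; last by apply: Rlt_le; apply: Rdiv_lt_0_compat; lra.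
apply: Rle_lt_trans kmaxpi.
have -> : 2 * delta * kmax = 2 * kmax / eps * h by rewrite /h; field; lra.
apply: Rmult_le_compat_l => //; apply: Rlt_le; apply: Rdiv_lt_0_compat; lra.
Qed.

Lemma Im_z i : Im (z i) = kap i.
Proof.
rewrite /z /zeta_n /zeta -/(kap i); case: Req_EM_T => //=.
Qed.

Lemma z_upper : in_upper_half z.
Proof. by move=> i; rewrite Im_complexE ltcR; apply/RltP; rewrite Im_z; have [] := kap0 i. Qed.

Lemma z_inj : injective z.
Proof. by move=> i j e; apply: kap_inj; rewrite -!Im_z e. Qed.

Lemma CN_cauchy : CN delta u0 xmax N = cauchy_mx z.
Proof. by apply/matrixP => i j; rewrite !mxE conj_cconj. Qed.

Lemma d_sqr q i : (d q i * d q i)%R = w q i.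
Proof.
rewrite /d GRing.mulrACA -RtoCM sqrt_sqrt; last by apply: Rlt_le; apply: exp_pos.
rewrite -cexpD /cexp !ReD !ImD !ReN !ImN !ReM !ImM [Re (RtoC _)]/= [Im (RtoC _)]/=.
rewrite [Re (RtoC _)]/= [Im (RtoC _)]/= [Re (Complex _ _)]/= [Im (Complex _ _)]/=.
set a := (X in exp X); set b := (X in cos X).
rewrite -[X in sin X]/b.
have -> : b = - (2 * kap i * q.2 / eps) by rewrite /b; field; lra.
have PE : P i q.1 = c_n delta u0 xmax N i.+1 * exp a.
  rewrite /P /c_n -exp_plus; congr exp.
  rewrite /a /Vk -/eps -/(kap i) -[zeta delta (kap i)]/(z i) -/(tau i).
  by field; lra.
by rewrite /w PE; apply: complex_eq; rewrite ?ReM ?ImM /=; ring.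
Qed.

Lemma P_gt0 i x : 0 < P i x. Proof. exact: exp_pos. Qed.

Lemma cabs_w q i : cabs (w q i) = P i q.1.
Proof. by rewrite cabs_polar //; apply: Rlt_le; apply: P_gt0. Qed.

Lemma w_neq0 q i : w q i <> RtoC 0.
Proof.
move=> e; have := cabs_w q i; have := P_gt0 i q.1.
by rewrite e /cabs /= Rmult_0_l Rplus_0_l sqrt_0; lra.
Qed.

Lemma w_sector x y i : Rabs y <= h -> sector (c * y) (w (x, y) i).
Proof.
move=> yh; have [k0 k1] := kap0 i.
(* The phase of w_i is the fraction kappa_i / kappa_max of the extreme angle c y. *)
have E : 2 * kap i * y / eps = kap i / kmax * (c * y) by rewrite /c; field; lra.
have r0 : 0 < kap i / kmax by apply: Rdiv_lt_0_compat; lra.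
have r1 : kap i / kmax <= 1 by apply/Rle_div_l; lra.
apply: sector_cis => /=; [exact: strip_angle|exact: P_gt0| |]; rewrite E.
  by move: (c * y) (kap i / kmax) r0 r1 => a b *; nra.
by move: (c * y) (kap i / kmax) r0 r1 => a b *; nra.
Qed.

Lemma ccont_w p i : ccont (fun q => w q i) p.
Proof.
have cc (f : R -> R) : (forall x, ex_derive f x) -> forall a, continuous f a.
  by move=> hf a; apply: ex_derive_continuous.
have c1 : continuous (fun q : R * R => P i q.1) p.
  apply: (continuous_comp fst (P i)); first by case: (p) => ? ?; apply: continuous_fst.
  by apply: cc => x; rewrite /P /Vk; auto_derive.
have c2 (g : R -> R) : (forall x, ex_derive g x) -> continuous (fun q : R * R => g q.2) p.
  move=> hg; apply: (continuous_comp snd g); first by case: (p) => ? ?; apply: continuous_snd.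
  exact: cc.
split => /=.
  apply: (continuous_mult (fun q : R * R => P i q.1)) => //.
  by apply: (c2 (fun y => cos (- (2 * kap i * y / eps)))) => x; auto_derive.
apply: (continuous_mult (fun q : R * R => P i q.1)) => //.
by apply: (c2 (fun y => sin (- (2 * kap i * y / eps)))) => x; auto_derive.
Qed.

Lemma Z_detP x y : Z x y = detP (d (x, y)) (d (x, y)) z.
Proof.
rewrite /Z /ZN /DeltaN /detP; congr (\det _)%R; apply/matrixP => i j.
by rewrite /DN CN_cauchy mul_mx_diag mul_diag_mx !mxE.
Qed.

(** (1 + D C D) D = D (1 + C D^2), and det D is nonzero. *)
Lemma Z_det x y : Z x y = (\det (1%:M + cauchy_mx z *m diag_mx (\row_i w (x, y) i)))%R.
Proof.
pose D := diag_mx (\row_i d (x, y) i)%R.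
have ZE : Z x y = (\det (1%:M + D *m cauchy_mx z *m D))%R by rewrite /Z /ZN /DeltaN CN_cauchy.
have dn i : d (x, y) i != 0%R.
  by apply/eqP => e; apply: (w_neq0 (x, y) i); rewrite -d_sqr e GRing.mul0r.
have D0 : (\det D != 0)%R by rewrite det_diag; apply/GRing.prodf_neq0 => i _; rewrite mxE.
have WE : diag_mx (\row_i w (x, y) i)%R = (D *m D)%R.
  apply/matrixP => i j; rewrite mul_diag_mx !mxE -d_sqr.
  by case: eqVneq => [->|_]; rewrite ?GRing.mulr1n ?GRing.mulr0n ?GRing.mulr0.
apply: (GRing.mulfI D0); rewrite ZE WE [LHS]GRing.mulrC -!det_mulmx.
by rewrite mulmxDl mulmxDr mul1mx mulmx1 !mulmxA.
Qed.

Lemma cauchy_unit : cauchy_mx z \in unitmx.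
Proof. by rewrite unitmxE GRing.unitfE Order.POrderTheory.gt_eqF // det_cauchy_gt0 //; [exact: z_upper|exact: z_inj]. Qed.

(** The factor det C is positive, so the second determinant carries the whole argument of Z. *)
Lemma Z_det_inv x y :
  Z x y = (\det (cauchy_mx z) * \det (invmx (cauchy_mx z) + diag_mx (\row_i w (x, y) i)))%R.
Proof. by rewrite Z_det -det_mulmx mulmxDr mulmxV // cauchy_unit. Qed.

Lemma polar_gt0 (a : R[i]) : (0 < a)%R -> polar a 0.
Proof.
move=> a0; have E : (`|a|)%R = a by apply: Num.Theory.ger0_norm; apply: Order.POrderTheory.ltW.
by rewrite /polar cos_0 sin_0 Rmult_1_r Rmult_0_r -{1}E norm_cabs.
Qed.

Lemma Z_lower x y : Rabs y <= h ->
  0 < dfun (2 * kmax * Rabs y / eps) ^ N <= cabs (Z x y).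
Proof.
move=> yh; have thpi := strip_angle y yh.
have E : 2 * kmax * Rabs y / eps = Rabs (c * y).
  rewrite /c Rabs_mult (Rabs_pos_eq (2 * kmax / eps)); last by apply: Rlt_le; apply: Rdiv_lt_0_compat; lra.
  by field; lra.
rewrite E; have d0 : 0 < dfun (Rabs (c * y)) by apply: dfun_gt0; split => //; apply: Rabs_pos.
split; first exact: pow_lt.
have w0 i : w (x, y) i != 0%R by apply/eqP; apply: w_neq0.
rewrite Z_det.
have [s [ss sK ->]] := det_1_add_psd_diag (sector1 _ thpi) (sectorD _ thpi) (sectorZ (c * y))
   (sector_pointed (c * y)) (psd_cauchy z_upper) (fun i => w_sector x y i yh) w0.
have -> : (\prod_(mu <- s) (1 + mu) = \prod_(mu <- [seq 1 + mu | mu <- s]) mu)%R by rewrite big_map.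
rewrite -{1}ss -(size_map (fun mu => 1 + mu)%R).
apply: pow_le_cabs_prod; first exact: Rlt_le.
by move=> mu /mapP [nu nus ->]; apply: sector_add1 => //; apply: sK.
Qed.

(** The moduli |w_i| depend on x alone, so the term-by-term majorant at x + i y is the one at the
    real point x. *)
Lemma Z_upper x y : cabs (Z x y) <=
  2 ^ N * exp (- (2 / (PI * eps ^ 2)) * EminN delta u0 xmax N x t).
Proof.
set B := exp _.
apply: RtoC_le; rewrite -norm_cabs Z_detP RtoCM.
have -> : RtoC (2 ^ N) = (2 ^+ N)%R.
  elim: N => [|n IH] //=; rewrite RtoCM IH GRing.exprS; congr (_ * _)%R.
  by apply: complex_eq; rewrite ?ReD ?ImD ?Re1 ?Im1 /=; ring.
apply: norm_detP_le => [||b]; [exact: z_upper|exact: z_inj|].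
pose F i := - (2 * Vk delta u0 xmax (kap i) x t) / eps.
(* Up to sign, the factor 2 / (pi eps^2) turns pi eps V into 2 V / eps, the exponent of |w_i|, and
   (pi eps^2 / 2) g into g, the exponent of the coupling. *)
have -> : subset_weight (fun i => `|d (x, y) i * d (x, y) i|)%R z b =
  RtoC (exp (- (2 / (PI * eps ^ 2)) * ENS delta u0 xmax (N := N) [set i | b i] x t)).
  rewrite /subset_weight.
  transitivity (\prod_(i | b i) RtoC (exp (F i + \big[Rplus/0]_(j | b j) - gfun (z i) (z j))))%R.
    apply: eq_bigr => i _; rewrite d_sqr norm_cabs cabs_w exp_plus RtoCM; congr (_ * _)%R.
    rewrite -prod_RtoC_exp; apply: eq_bigr => j _.
    by apply: coupling_gfun; rewrite Im_z; apply: (proj1 (kap0 _)).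
  rewrite prod_RtoC_exp; congr (RtoC (exp _)).
  pose g i j := gfun (z i) (z j).
  transitivity (\big[Rplus/0]_(i | b i) (- (2 / eps) * Vk delta u0 xmax (kap i) x t
      + -1 * \big[Rplus/0]_(j | b j) g i j)).
    apply: eq_bigr => i _; rewrite /F.
    have -> : \big[Rplus/0]_(j | b j) - gfun (z i) (z j) = -1 * \big[Rplus/0]_(j | b j) g i j.
      transitivity (\big[Rplus/0]_(j | b j) (-1 * g i j + 0 * g i j)).
        by apply: eq_bigr => j _; rewrite /g; ring.
      by rewrite bigRplus_lin; ring.
    by field; lra.
  rewrite bigRplus_lin /ENS -/eps.
  have -> : \big[Rplus/0]_(i in [set i | b i]) Vk delta u0 xmax (kap i) x t =
      \big[Rplus/0]_(i | b i) Vk delta u0 xmax (kap i) x t.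
    by apply: eq_bigl => i; rewrite inE.
  have -> : \big[Rplus/0]_(i in [set i | b i]) \big[Rplus/0]_(l in [set i | b i]) g i l =
      \big[Rplus/0]_(i | b i) \big[Rplus/0]_(j | b j) g i j.
    by apply: eq_big => [i|i _]; [rewrite inE|apply: eq_bigl => j; rewrite inE].
  by field; split; [lra|have := PI_RGT_0; lra].
apply: le_RtoC; rewrite /B; apply: exp_nondecreasing.
have mn := bigmin_le _ (fun S => ENS delta u0 xmax (N := N) S x t) (ENS delta u0 xmax (N := N) set0 x t) [set i | b i].
rewrite -/(EminN delta u0 xmax N x t) in mn.
have e2 : 0 < 2 / (PI * eps ^ 2).
  by apply: Rdiv_lt_0_compat; [lra|apply: Rmult_lt_0_compat; [exact: PI_RGT_0|exact: pow_lt]].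
by move: (EminN _ _ _ _ _ _) (ENS _ _ _ _ _ _) (2 / _) mn e2 => ? ? ? ? ?; nra.
Qed.

Lemma h_gt0 : 0 < h.
Proof. exact: Rmult_lt_0_compat. Qed.

Lemma Z_neq0 x y : Rabs y <= h -> Z x y <> RtoC 0.
Proof.
move=> yh e; have := Z_lower x y yh.
have c0 : cabs (RtoC 0) = 0 by rewrite /cabs /= !Rmult_0_l Rplus_0_l sqrt_0.
by rewrite e c0; lra.
Qed.

Lemma exists_arg_Z : exists phi : R -> R -> R,
  [/\ continuous_on_strip h phi, forall x, phi x 0 = 0,
   forall x y, Rabs y <= h -> polar (Z x y) (phi x y) &
   forall x y, Rabs y <= h -> 0 <= - sgn y * phi x y <= 2 * INR N * kmax * Rabs y / eps].
Proof.
have [phi hphi] := exists_arg_det_add_diag c h _ _ w strip_angle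
  (psd_invmx _ _ _ cauchy_unit (psd_cauchy z_upper))
  (fun x y i yh => conj (w_sector x y i yh) (w_neq0 (x, y) i)) ccont_w.
have c0 : 0 < c by apply: Rdiv_lt_0_compat; lra.
exists (fun x y => phi (x, y)); split.
- move=> x y yh e e0; have [cp _ _ _] := hphi x y yh.
  have [[dl d0] hd] := cp _ (locally_ball (phi (x, y)) (mkposreal e e0)).
  exists dl; split => // x' y' _ hx hy; exact: (hd (x', y') (conj hx hy)).
(* At y = 0 the two one-sided bounds meet and force phi = 0. *)
- move=> x; have [|_ _ h1 h2] := hphi x 0; first by rewrite Rabs_R0; apply: Rlt_le; apply: h_gt0.
  rewrite !Rmult_0_r in h1 h2; have := h1 (Rle_refl 0); have := h2 (Rle_refl 0); rewrite /=; lra.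
- move=> x y yh; have [_ hp _ _] := hphi x y yh.
  rewrite Z_det_inv -[phi (x, y)]Rplus_0_l; apply: polar_mul hp.
  by apply: polar_gt0; apply: det_cauchy_gt0; [exact: z_upper|exact: z_inj].
move=> x y yh; have [_ _ h1 h2] := hphi x y yh.
have E : 2 * INR N * kmax * Rabs y / eps = INR N * (c * Rabs y) by rewrite /c; field; lra.
rewrite E /sgn; case: Rlt_dec => y1 /=.
  rewrite (Rabs_pos_eq y); last lra.
  by have := h1 (ltac:(nra)); lra.
case: Rlt_dec => y2 /=.
  by rewrite Rabs_left //; have := h2 (ltac:(nra)); lra.
have -> : y = 0 by lra.
by rewrite Rabs_R0; lra.
Qed.

Lemma strip_conclusion :
  (forall x y, Rabs y <= h ->
     0 < dfun (2 * kmax * Rabs y / eps) ^ N /\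
     dfun (2 * kmax * Rabs y / eps) ^ N <= cabs (Z x y) /\
     cabs (Z x y) <= 2 ^ N * exp (- (2 / (PI * eps ^ 2)) * EminN delta u0 xmax N x t)) /\
  (forall x y, Rabs y <= h -> Z x y <> RtoC 0) /\
  (forall x, Im (Z x 0) = 0 /\ 0 < Re (Z x 0)) /\
  (exists phi : R -> R -> R,
     continuous_on_strip h phi /\
     (forall x, phi x 0 = 0) /\
     (forall x y, Rabs y <= h -> polar (Z x y) (phi x y))) /\
  (forall phi : R -> R -> R,
     continuous_on_strip h phi ->
     (forall x, phi x 0 = 0) ->
     (forall x y, Rabs y <= h -> polar (Z x y) (phi x y)) ->
     forall x y, Rabs y <= h ->
       0 <= - sgn y * phi x y <= 2 * INR N * kmax * Rabs y / eps).
Proof.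
have [phi [h1 h2 h3 h4]] := exists_arg_Z.
split.
  move=> x y yh; have [? ?] := Z_lower x y yh; split => //; split => //; exact: Z_upper.
split; first exact: Z_neq0.
split.
  (* Positivity on the real axis is read off from the argument being 0 there and Z being nonzero. *)
  move=> x; have yh : Rabs 0 <= h by rewrite Rabs_R0; apply: Rlt_le; apply: h_gt0.
  rewrite (h3 x 0 yh) h2 cos_0 sin_0 /= Rmult_0_r Rmult_1_r; split => //.
  exact/cabs_gt0/Z_neq0.
split; first by exists phi.
move=> psi p1 p2 p3 x y yh.
rewrite -(strip_arg_unique h Z phi psi Z_neq0 h1 p1 h2 p2 h3 p3 x y yh).
exact: h4.
Qed.

End Strip.

(** * Real and complex branches of the Lambert function *)

(* [2 delta E(zeta(kappa))] as a function of [eta = 2 delta kappa], 0 < eta < pi. *)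
Definition qfun (eta : R) : R := 1 + ln (eta / sin eta) - eta * (cos eta / sin eta).

Lemma derive_ge0_incr (f df : R -> R) a b : a <= b ->
  (forall x, a <= x <= b -> is_derive f x (df x)) ->
  (forall x, a <= x <= b -> 0 <= df x) -> f a <= f b.
Proof.
move=> [ab|->]; last by lra.
move=> hd hp.
have [|c [E hc]] := MVT_cor2 f df a b ab.
  by move=> x xab; apply/is_derive_Reals; apply: hd.
suff : 0 <= df c * (b - a) by lra.
by apply: Rmult_le_pos; [apply: hp|]; lra.
Qed.

(** The derivative is a sum of squares over eta, hence positive; through [Ek_qfun] this is the
    growth of E along kappa. *)
Lemma qfun_derive eta : 0 < eta < PI ->
  is_derive qfun eta (((1 - eta * (cos eta / sin eta)) ^ 2 + eta ^ 2) / eta).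
Proof.
move=> [e0 ePI]; have s0 := sin_gt_0 eta e0 ePI.
have c2 : cos eta ^ 2 = 1 - sin eta ^ 2 by have := sin2_cos2 eta; rewrite /Rsqr; lra.
rewrite /qfun; auto_derive.
  by repeat split; [lra|apply: Rdiv_lt_0_compat; lra|lra].
have E : cos eta * cos eta = 1 - sin eta * sin eta by rewrite -[sin eta * sin eta]Rmult_1_r; lra.
field_simplify; [|lra|lra].
by rewrite -/(cos eta ^ 2) c2; field; lra.
Qed.

Lemma qfun_lt a b : 0 < a -> a < b -> b < PI -> qfun a < qfun b.
Proof.
move=> a0 ab bpi.
have [|c [E hc]] := MVT_cor2 qfun (fun eta => ((1 - eta * (cos eta / sin eta)) ^ 2 + eta ^ 2) / eta) a b ab.
  by move=> x xab; apply/is_derive_Reals; apply: qfun_derive; lra.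
suff : 0 < qfun b - qfun a by lra.
rewrite E; apply: Rmult_lt_0_compat; last lra.
apply: Rdiv_lt_0_compat; last lra.
have := pow2_ge_0 (1 - c * (cos c / sin c)); have := pow_lt c 2 (ltac:(lra)); lra.
Qed.

Lemma ln_le_sub1 x : 0 < x -> ln x <= x - 1.
Proof. by move=> x0; have := exp_ineq1_le (ln x); rewrite exp_ln //; lra. Qed.

Lemma mul_cos_le_sin x : 0 <= x <= PI -> x * cos x <= sin x.
Proof.
move=> [x0 xpi].
have := derive_ge0_incr (fun y => sin y - y * cos y) (fun y => y * sin y) 0 x x0.
rewrite sin_0 Rmult_0_l => H; suff : 0 - 0 <= sin x - x * cos x by lra.
apply: H => y hy; first by auto_derive => //; ring.
by apply: Rmult_le_pos; [lra|apply: sin_ge_0; lra].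
Qed.

Lemma qfun_surj s : 0 < s -> exists eta, 0 < eta < PI /\ qfun eta = s.
Proof.
move=> s0; have pi0 := PI_RGT_0; have pi2 := PI2_1.
(* With cos a = v and r = a / sin a, a cos a <= sin a gives r <= 1 / v = 1 + s / 2, and ln r <= r -
   1 gives qfun a <= r (1 - v) <= s / 2. *)
pose v := / (1 + s / 2).
have v0 : 0 < v by apply: Rinv_0_lt_compat; lra.
have vE : v * (1 + s / 2) = 1 by rewrite /v; field; lra.
have v1 : v < 1 by nra.
pose a := acos v.
have ca : cos a = v by apply: cos_acos; lra.
have [a0 api] := acos_bound v; rewrite -/a in a0 api.
have a0' : 0 < a.
  by case: a0 => // a00; move: ca; rewrite -a00 cos_0; lra.
have a2 : a < PI / 2.
  have [//|h] := Rlt_le_dec a (PI / 2); have := cos_le_0 a h; lra.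
have sa : 0 < sin a by apply: sin_gt_0; lra.
have qa : qfun a < s.
  have h1 := mul_cos_le_sin a (ltac:(lra)); rewrite ca in h1.
  have sx := sin_lt_x a a0'.
  have b1 : a / sin a <= 1 + s / 2 by apply/Rle_div_l => //; nra.
  have b2 : 1 <= a / sin a by apply/Rle_div_r => //; lra.
  have h2 := ln_le_sub1 (a / sin a) (ltac:(lra)).
  rewrite /qfun ca.
  have -> : a * (v / sin a) = a / sin a * v by field; lra.
  nra.
(* Chosen so that -cot b = s + 1 at b = pi - be; as b > 1 and b / sin b >= 1, qfun b exceeds s. *)
pose be := atan (/ (s + 1)).
have is0 : 0 < / (s + 1) by apply: Rinv_0_lt_compat; lra.
have be0 : 0 < be by rewrite -atan_0; apply: atan_increasing.
have be2 : be < PI / 2 by have := atan_bound (/ (s + 1)); rewrite -/be; lra.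
pose b := PI - be.
have sb : sin b = sin be by rewrite /b sin_PI_x.
have cb : cos b = - cos be by rewrite /b cos_minus cos_PI sin_PI; ring.
have sbe : 0 < sin be by apply: sin_gt_0; lra.
have cbe : 0 < cos be by apply: cos_gt_0; lra.
have qb : s < qfun b.
  have tb : cos be / sin be = s + 1.
    have tE : tan be = / (s + 1) by rewrite /be tan_atan.
    rewrite -[RHS]Rinv_inv -tE /tan; field; lra.
  rewrite /qfun cb sb.
  have -> : b * (- cos be / sin be) = - (b * (s + 1)) by rewrite -tb; field; lra.
  have l0 : 0 <= ln (b / sin be).
    rewrite -ln_1; apply: ln_le; first lra.
    by apply/Rle_div_r => //; have := SIN_bound be; rewrite /b; lra.
  have b1 : 1 < b by rewrite /b; lra.
  nra.
have ab : a < b by rewrite /b; lra.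
have [|c [hc ec]] := IVT_interv (fun x => qfun x - s) a b _ ab (ltac:(cbv beta; lra)) (ltac:(cbv beta; lra)).
  move=> x hx; apply: continuity_pt_minus; last by apply: continuity_pt_const => ? ?.
  apply: derivable_continuous_pt; exists (((1 - x * (cos x / sin x)) ^ 2 + x ^ 2) / x).
  by apply/is_derive_Reals; apply: qfun_derive; rewrite /b in hx; lra.
by exists c; rewrite /b in hc; split; lra.
Qed.

(** For w = - eta cot eta + i eta = - (eta / sin eta) exp (- i eta), the left side is - w exp w, so
    [qfun] parametrizes the complex branch of W. *)
Lemma exp_qfun eta : 0 < eta < PI ->
  exp (- (eta * (cos eta / sin eta))) * (eta / sin eta) = exp (qfun eta - 1).
Proof.
move=> [h1 h2]; have s0 := sin_gt_0 _ h1 h2.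
rewrite -(exp_ln (eta / sin eta)); last by apply: Rdiv_lt_0_compat.
by rewrite -exp_plus /qfun; congr exp; ring.
Qed.

Lemma LambertW0_complex s : 0 < s ->
  0 < Im (LambertW0 (- exp (s - 1))) < PI /\ qfun (Im (LambertW0 (- exp (s - 1)))) = s.
Proof.
move=> s0; set a := - exp (s - 1).
have alt : a < - exp (-1) by have := exp_increasing (-1) (s - 1); rewrite /a; lra.
have spec : W0_spec a (LambertW0 a).
  apply: epsilon_spec; have [eta [he hq]] := qfun_surj s s0.
  have si : 0 < sin eta by apply: sin_gt_0; lra.
  exists (Complex (- (eta * (cos eta / sin eta))) eta); split; last by right.
  have k := exp_qfun eta he; rewrite hq in k.
  have cs := sin2_cos2 eta; rewrite /Rsqr in cs.
  apply: complex_eq; rewrite ?ReM ?ImM /=; last by field; lra.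
  rewrite /a -k -[RHS]Rmult_1_r -cs; field; lra.
case: spec => e [[h _]|[_ [h1 h2]]]; first lra.
move: e h1 h2; move: (LambertW0 a) => [x y] /= e y0 ypi; split => //.
have si : 0 < sin y by apply: sin_gt_0.
have ex := exp_pos x.
have e1 : x * (exp x * cos y) - y * (exp x * sin y) = a := congr1 (@Re R) e.
have e2 : x * (exp x * sin y) + y * (exp x * cos y) = 0.
  by have := congr1 (@Im R) e; rewrite ImM.
(* The imaginary part of w exp w vanishes, which forces w onto the curve of [exp_qfun]. *)
have xE : x = - (y * (cos y / sin y)).
  have : exp x * (x * sin y + y * cos y) = 0 by lra.
  move/Rmult_integral => [|h]; first lra.
  apply: (Rmult_eq_reg_r (sin y)); last lra.
  by rewrite (_ : - (y * (cos y / sin y)) * sin y = - (y * cos y)); [lra|field; lra].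
have k := exp_qfun y (conj y0 ypi); rewrite -xE in k.
have cs := sin2_cos2 y; rewrite /Rsqr in cs.
have : exp x * (y / sin y) = exp (s - 1).
  have : exp (s - 1) = - a by rewrite /a; ring.
  move=> ->; rewrite -e1 {2}xE -[LHS]Rmult_1_r -cs; field; lra.
by rewrite k => /exp_inv; lra.
Qed.

(** The minus sign in [zeta_max] cancels the conjugation in W_{-1}, so 2 delta kappa_max = Im
    W_0. *)
Lemma kappa_max_spec delta u0 xmax : 0 < delta -> 0 < u0 xmax ->
  0 < kappa_max delta u0 xmax /\ 2 * delta * kappa_max delta u0 xmax < PI /\
  qfun (2 * delta * kappa_max delta u0 xmax) = 2 * delta * u0 xmax.
Proof.
move=> d0 u00; have s0 : 0 < 2 * delta * u0 xmax by nra.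
have [[h1 h2] h3] := LambertW0_complex _ s0.
have kE : kappa_max delta u0 xmax = Im (LambertW0 (- exp (2 * delta * u0 xmax - 1))) / (2 * delta).
  rewrite /kappa_max /zeta_max /umax /LambertWm1.
  have alt : - exp (2 * delta * u0 xmax - 1) < - exp (-1).
    by apply: Ropp_lt_contravar; apply: exp_increasing; lra.
  case: Rlt_dec => [h|//].
  rewrite ImM ReN ImN /=; field; lra.
have E : 2 * delta * kappa_max delta u0 xmax = Im (LambertW0 (- exp (2 * delta * u0 xmax - 1))).
  by rewrite kE; field; lra.
rewrite E; split; [rewrite kE; apply: Rdiv_lt_0_compat; lra|by []].
Qed.

(** At a = - exp (-1 - s), p = -W solves p - ln p - 1 = s. The root for W_0 is at most 1, the one
    for W_{-1} at least 1. *)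
Definition negW0 (s : R) : R := - Re (LambertW0 (- exp (- (1) - s))).
Definition negWm1 (s : R) : R := - Re (LambertWm1 (- exp (- (1) - s))).

Lemma sub_ln_continuity a b : 0 < a -> forall x, a <= x <= b -> continuity_pt (fun p => p - ln p - 1) x.
Proof.
move=> a0 x hx; apply: derivable_continuous_pt; exists (1 - / x).
by apply/is_derive_Reals; auto_derive; lra.
Qed.

Lemma sub_ln_exp p s : 0 < p -> p - ln p - 1 = s -> - p * exp (- p) = - exp (- (1) - s).
Proof. by move=> p0 <-; rewrite -{1}(exp_ln p p0) Ropp_mult_distr_l_reverse -exp_plus; congr (- exp _); ring. Qed.

Lemma sub_ln_exp_inv p s : 0 < p -> - p * exp (- p) = - exp (- (1) - s) -> p - ln p - 1 = s.
Proof.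
move=> p0; rewrite -{1}(exp_ln p p0) Ropp_mult_distr_l_reverse -exp_plus => h.
have /exp_inv : exp (ln p + - p) = exp (- (1) - s) by lra.
lra.
Qed.

Lemma negW0_spec s : 0 <= s -> 0 < negW0 s <= 1 /\ negW0 s - ln (negW0 s) - 1 = s.
Proof.
move=> s0; set a := - exp (- (1) - s).
have age : - exp (-1) <= a.
  by rewrite /a; have := exp_nondecreasing (- (1) - s) (-1); lra.
have aneg : a < 0 by have := exp_pos (- (1) - s); rewrite /a; lra.
have spec : W0_spec a (LambertW0 a).
  apply: epsilon_spec.
  have [p [p0 [p1 hp]]] : exists p, 0 < p /\ p <= 1 /\ p - ln p - 1 = s.
    have e0 := exp_pos (- (1) - s).
    case: (Req_EM_T s 0) => [->|sn].
      by exists 1; rewrite ln_1; lra.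
    have e1 : exp (- (1) - s) < 1 by have := exp_increasing (- (1) - s) 0; rewrite exp_0; lra.
    (* At p = exp (-1 - s) one has p - ln p - 1 = p + s > s, and at p = 1 the value is 0. *)
    have [|p [hp ep]] := IVT_interv (fun p => - (p - ln p - 1) + s) (exp (- (1) - s)) 1 _ e1 (ltac:(cbv beta; rewrite ln_exp; lra)) (ltac:(cbv beta; rewrite ln_1; lra)).
      move=> x hx; apply: continuity_pt_plus; last by apply: continuity_pt_const => ? ?.
      by apply: continuity_pt_opp; apply: (sub_ln_continuity _ 1 e0).
    by exists p; lra.
  exists (RtoC (- p)); split.
    have k := sub_ln_exp p s p0 hp.
    apply: complex_eq; rewrite ?ReM ?ImM /= cos_0 sin_0 ?Rmult_1_r; last by ring.
    by rewrite k /a; ring.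
  by left; rewrite /=; lra.
case: spec => e [[_ [h1 h2]]|[h _]]; last lra.
rewrite /negW0 -/a; move: e h1 h2; move: (LambertW0 a) => [x y] /= e y0 hx.
split; first lra.
have e1 : x * (exp x * cos y) - y * (exp x * sin y) = a := congr1 (@Re R) e.
apply: sub_ln_exp_inv; first lra.
by rewrite !Ropp_involutive -/a -e1 y0 cos_0; ring.
Qed.

Lemma negWm1_spec s : 0 <= s -> 1 <= negWm1 s /\ negWm1 s - ln (negWm1 s) - 1 = s.
Proof.
move=> s0; set a := - exp (- (1) - s).
have age : - exp (-1) <= a.
  by rewrite /a; have := exp_nondecreasing (- (1) - s) (-1); lra.
have WE : LambertWm1 a = epsilon (inhabits (RtoC 0)) (Wm1_spec a).
  by rewrite /LambertWm1; case: Rlt_dec => // h; lra.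
have spec : Wm1_spec a (LambertWm1 a).
  rewrite WE; apply: epsilon_spec.
  have [p [p1 hp]] : exists p, 1 <= p /\ p - ln p - 1 = s.
    case: (Req_EM_T s 0) => [->|sn].
      by exists 1; rewrite ln_1; lra.
    (* ln (2 s + 3) = ln 2 + ln (s + 3/2) <= s + 3/2, which leaves a margin of 1/2 at this
       endpoint. *)
    have ls : 0 < 2 * s + 3 - ln (2 * s + 3) - 1 - s.
      have {2}-> : 2 * s + 3 = 2 * (s + 3 / 2) by field.
      rewrite ln_mult; [|lra|lra].
      by have := ln_le_sub1 2; have := ln_le_sub1 (s + 3 / 2); lra.
    have [|p [hp ep]] := IVT_interv (fun p => (p - ln p - 1) - s) 1 (2 * s + 3) _ (ltac:(lra)) (ltac:(cbv beta; rewrite ln_1; lra)) ls.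
      move=> x hx; apply: continuity_pt_minus; last by apply: continuity_pt_const => ? ?.
      exact: (sub_ln_continuity 1 (2 * s + 3) Rlt_0_1).
    by exists p; lra.
  exists (RtoC (- p)); split; last by rewrite /=; lra.
  have k := sub_ln_exp p s (ltac:(lra)) hp.
  apply: complex_eq; rewrite ?ReM ?ImM /= cos_0 sin_0 ?Rmult_1_r; last by ring.
  by rewrite k /a; ring.
case: spec => e [h1 h2].
rewrite /negWm1 -/a; move: e h1 h2; move: (LambertWm1 a) => [x y] /= e y0 hx.
split; first lra.
have e1 : x * (exp x * cos y) - y * (exp x * sin y) = a := congr1 (@Re R) e.
apply: sub_ln_exp_inv; first lra.
by rewrite !Ropp_involutive -/a -e1 y0 cos_0; ring.
Qed.

(** A rewriting of ln x <= (x - 1/x) / 2 for x = 1 + d; the quadratic gain produces the square root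
    in [negWm1_modulus]. *)
Lemma ln_1p_le d : 0 <= d -> ln (1 + d) <= d - d ^ 2 / (2 * (1 + d)).
Proof.
move=> d0.
have := derive_ge0_incr (fun x => (x - / x) / 2 - ln x) (fun x => (1 - / x) ^ 2 / 2) 1 (1 + d) (ltac:(lra)).
rewrite ln_1 => H.
have : (1 - / 1) / 2 - 0 <= (1 + d - / (1 + d)) / 2 - ln (1 + d).
  apply: H => x hx; first by auto_derive; [lra|field; lra].
  by have := pow2_ge_0 (1 - / x); lra.
have -> : d - d ^ 2 / (2 * (1 + d)) = (1 + d - / (1 + d)) / 2 by field; lra.
by rewrite Rinv_1; lra.
Qed.

Lemma ln_1m_le e : 0 <= e < 1 -> ln (1 - e) <= - e - e ^ 2 / 2.
Proof.
move=> [e0 e1].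
have := derive_ge0_incr (fun x => - x - x ^ 2 / 2 - ln (1 - x)) (fun x => x ^ 2 / (1 - x)) 0 e e0.
rewrite Rminus_0_r ln_1 => H.
have : - 0 - 0 ^ 2 / 2 - 0 <= - e - e ^ 2 / 2 - ln (1 - e).
  apply: H => x hx; first by auto_derive; [lra|field; lra].
  by apply: Rmult_le_pos; [apply: pow2_ge_0|apply: Rlt_le; apply: Rinv_0_lt_compat; lra].
by lra.
Qed.

(** p - ln p - 1 has a double zero at 1, so its inverse is only Hoelder 1/2 there; the linear term
    accounts for large p. *)
Lemma negWm1_modulus s s' : 0 <= s <= s' ->
  0 <= negWm1 s' - negWm1 s <= 2 * (s' - s) + sqrt (2 * (s' - s)).
Proof.
move=> [s0 [ss|<-]]; last first.
  by rewrite !Rminus_diag Rmult_0_r sqrt_0; lra.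
have [a1 a2] := negWm1_spec s s0; have [b1 b2] := negWm1_spec s' (ltac:(lra)).
move: (negWm1 s) (negWm1 s') a1 a2 b1 b2 => p p' a1 a2 b1 b2.
have d0 : 0 <= p' - p.
  have [//|h] := Rle_lt_dec 0 (p' - p).
  have := ln_le_sub1 (p / p') (ltac:(apply: Rdiv_lt_0_compat; lra)).
  rewrite ln_div; [|lra|lra].
  have -> : p / p' - 1 = (p - p') * / p' by field; lra.
  have : / p' <= 1 by rewrite -Rinv_1; apply: Rinv_le_contravar; lra.
  by move: (/ p') => q; nra.
split => //.
have r0 : 0 <= 2 * (s' - s) by lra.
have sq := sqrt_sqrt _ r0; have sq0 := sqrt_pos (2 * (s' - s)).
have l1 : ln p' - ln p <= ln (1 + (p' - p)).
  rewrite -ln_div; [|lra|lra]; apply: ln_le; first by apply: Rdiv_lt_0_compat; lra.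
  by apply/Rle_div_l; nra.
have l2 := ln_1p_le _ d0.
move: l1 l2 d0; set d := p' - p => l1 l2 d0.
(* Since p >= 1, p' / p <= 1 + d. With r = 2 (s' - s), d > r + sqrt r would contradict d^2 <= r (1 +
   d). *)
have key : d ^ 2 / (2 * (1 + d)) <= s' - s by rewrite /d in l1 l2 *; lra.
have key2 : d ^ 2 <= 2 * (s' - s) * (1 + d).
  by move: key => /Rle_div_l; lra.
have [//|h] := Rle_lt_dec d (2 * (s' - s) + sqrt (2 * (s' - s))).
move: sq sq0 r0 key2 h; move: (sqrt (2 * (s' - s))) => g; move: (2 * (s' - s)) => r *; nra.
Qed.

(** Here p <= 1 gives p' / p <= 1 - (p - p'), and since p stays bounded no linear term arises. *)
Lemma negW0_modulus s s' : 0 <= s <= s' ->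
  0 <= negW0 s - negW0 s' <= sqrt (2 * (s' - s)).
Proof.
move=> [s0 [ss|<-]]; last first.
  by rewrite !Rminus_diag Rmult_0_r sqrt_0; lra.
have [a1 a2] := negW0_spec s s0; have [b1 b2] := negW0_spec s' (ltac:(lra)).
move: (negW0 s) (negW0 s') a1 a2 b1 b2 => p p' a1 a2 b1 b2.
have d0 : 0 <= p - p'.
  have [//|h] := Rle_lt_dec 0 (p - p').
  have := ln_le_sub1 (p / p') (ltac:(apply: Rdiv_lt_0_compat; lra)).
  rewrite ln_div; [|lra|lra].
  have -> : p / p' - 1 = (p - p') * / p' by field; lra.
  have : 1 <= / p' by rewrite -Rinv_1; apply: Rinv_le_contravar; lra.
  by move: (/ p') => q; nra.
split => //.
have r0 : 0 <= 2 * (s' - s) by lra.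
have l1 : ln p' - ln p <= ln (1 - (p - p')).
  rewrite -ln_div; [|lra|lra]; apply: ln_le; first by apply: Rdiv_lt_0_compat; lra.
  by apply/Rle_div_l; nra.
have e1 : p - p' < 1 by lra.
have l2 := ln_1m_le _ (conj d0 e1).
apply: Rsqr_incr_0_var (sqrt_pos _); rewrite /Rsqr sqrt_sqrt //.
move: l1 l2 d0; set e := p - p' => l1 l2 d0.
by have -> : e * e = e ^ 2 by [ring|]; rewrite /e in l1 l2 *; lra.
Qed.

(* [W_0 - W_{-1}] at [- exp (-1 - s)] for s >= 0, extended by 0 to s < 0; [Wmod] is a modulus of continuity. *)
Definition Wgap (s : R) : R := negWm1 (Rmax 0 s) - negW0 (Rmax 0 s).
Definition Wmod (r : R) : R := 2 * r + 2 * sqrt (2 * r).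

Lemma Wgap_0 s : s <= 0 -> Wgap s = 0.
Proof.
move=> s0; rewrite /Wgap Rmax_left //.
have E p : 0 < p -> p - ln p - 1 = 0 -> p = 1.
  move=> p0 h; have [l|[//|l]] := Rtotal_order p 1.
    by have := ln_1m_le (1 - p) (ltac:(lra)); have -> : 1 - (1 - p) = p by [ring|]; nra.
  have := ln_1p_le (p - 1) (ltac:(lra)); have -> : 1 + (p - 1) = p by ring.
  have : 0 < (p - 1) ^ 2 / (2 * p) by apply: Rdiv_lt_0_compat; [apply: pow_lt; lra|lra].
  by lra.
have [[h1 _] h2] := negW0_spec 0 (Rle_refl 0); have [h3 h4] := negWm1_spec 0 (Rle_refl 0).
have := E _ h1 h2; have := E _ (Rlt_le_trans _ _ _ Rlt_0_1 h3) h4; lra.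
Qed.

Lemma Wgap_gt0 s : 0 < s -> 0 < Wgap s.
Proof.
move=> s0; rewrite /Wgap Rmax_right; last lra.
have [[? ?] h1] := negW0_spec s (Rlt_le _ _ s0); have [? h2] := negWm1_spec s (Rlt_le _ _ s0).
have [//|h] := Rlt_le_dec 0 (negWm1 s - negW0 s).
have e : negWm1 s = 1 by lra.
by rewrite e ln_1 in h2; lra.
Qed.

Lemma Wgap_ge0 s : 0 <= Wgap s.
Proof.
have [h|h] := Rle_lt_dec s 0; first by rewrite Wgap_0 //; lra.
exact/Rlt_le/Wgap_gt0.
Qed.

Lemma Wmod_incr r r' : 0 <= r <= r' -> Wmod r <= Wmod r'.
Proof.
move=> h; rewrite /Wmod; have := sqrt_le_1_alt (2 * r) (2 * r') (ltac:(lra)); lra.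
Qed.

Lemma Wgap_modulus s s' : Rabs (Wgap s - Wgap s') <= Wmod (Rabs (s - s')).
Proof.
have main a b : a <= b -> Rabs (Wgap a - Wgap b) <= Wmod (b - a).
  move=> ab; rewrite /Wgap.
  have h : 0 <= Rmax 0 a <= Rmax 0 b by split; [exact: Rmax_l|exact: Rle_max_compat_l].
  have h1 := negWm1_modulus _ _ h; have h2 := negW0_modulus _ _ h.
  apply: Rle_trans (Wmod_incr (Rmax 0 b - Rmax 0 a) _ _).
    by rewrite /Wmod; apply/Rabs_le_between; lra.
  split; first lra.
  have [?|?] := Rle_lt_dec b 0; first by rewrite !Rmax_left; lra.
  rewrite (Rmax_right 0 b); last lra.
  have := Rmax_r 0 a; lra.
have [h|h] := Rle_lt_dec s s'.
  by have := main _ _ h; rewrite [Rabs (s - s')]Rabs_minus_sym [Rabs (s' - s)]Rabs_pos_eq //; lra.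
by rewrite Rabs_minus_sym [Rabs (s - s')]Rabs_pos_eq; [apply: main|]; lra.
Qed.

(** * The Weyl law and the spectral points *)

(** A rise from x to y followed by decay to 0 would give an interior maximum to the right of x >= m,
    hence a second critical point. *)
Lemma unimodal_decreasing (u : R -> R) (m : R) :
  (forall x, ex_derive u x) -> (forall x, 0 < u x) -> is_lim u p_infty 0 ->
  (forall x, Derive u x = 0 -> x = m) ->
  forall x y, m <= x <= y -> u y <= u x.
Proof.
move=> hd hu hlim hc x y [mx xy].
have [//|lt] := Rle_lt_dec (u y) (u x).
have [M hM] : exists M, forall w, M < w -> u w < u x.
  have [M hM] := proj2 (is_lim_spec _ _ _) hlim (mkposreal _ (hu x)).
  exists M => w Mw; have := hM w Mw; rewrite /= Rminus_0_r => h.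
  by have := Rle_abs (u w); lra.
have xy' : x < y by case: xy => // e; move: lt; rewrite e; lra.
pose b := Rmax y M + 1.
have by' : y < b by rewrite /b; have := Rmax_l y M; lra.
have ub : u b < u x by apply: hM; rewrite /b; have := Rmax_r y M; lra.
have cont w : continuity_pt u w.
  by apply/continuity_pt_filterlim; apply: ex_derive_continuous.
have [c [cmax hcb]] := continuity_ab_maj u x b (ltac:(lra)) (fun w _ => cont w).
have cy := cmax y (ltac:(lra)).
have c1 : x < c by case: (proj1 hcb) => // e; move: cy; rewrite -e; lra.
have c2 : c < b by case: (proj2 hcb) => // e; move: cy; rewrite e; lra.
have pr : derivable_pt u c by exists (Derive u c); apply/is_derive_Reals; apply: Derive_correct.
have d0 := deriv_maximum u x b c pr c1 c2 (fun w h1 h2 => cmax w (conj (Rlt_le _ _ h1) (Rlt_le _ _ h2))).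
have : c = m by apply: hc; rewrite -(Derive_Reals u c pr).
lra.
Qed.

Lemma unimodal_increasing (u : R -> R) (m : R) :
  (forall x, ex_derive u x) -> (forall x, 0 < u x) -> is_lim u m_infty 0 ->
  (forall x, Derive u x = 0 -> x = m) ->
  forall x y, x <= y <= m -> u x <= u y.
Proof.
move=> hd hu hlim hc x y xym.
have := unimodal_decreasing (fun w => u (- w)) (- m) _ _ _ _ (- y) (- x).
rewrite !Ropp_involutive; apply; last lra.
- by move=> w; apply: (ex_derive_comp u Ropp) => //; auto_derive.
- by move=> w; apply: hu.
- apply/is_lim_spec => e; have [M hM] := proj2 (is_lim_spec _ _ _) hlim e.
  by exists (- M) => w hw; apply: hM; lra.
move=> w; have -> : Derive (fun w => u (- w)) w = - Derive u (- w).
  apply: is_derive_unique; auto_derive; [exact: hd|transitivity (- (1) * Derive u (- w)); [by []|ring]].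
by move=> h; have := hc (- w) (ltac:(lra)); lra.
Qed.

Section Branches.
Variables (delta : R) (u0 : R -> R) (xmax : R).
Hypothesis delta0 : 0 < delta.

Lemma scaled_zeta k : 0 < k -> 2 * delta * k < PI ->
  let eta := 2 * delta * k in
  (RtoC (2 * delta) * zeta delta k)%R = Complex (eta * (cos eta / sin eta)) eta.
Proof.
move=> k0 kpi eta; rewrite /zeta; case: Req_EM_T => [e|_] /=; first lra.
by apply: complex_eq; rewrite ?ReM ?ImM /= /eta; ring.
Qed.

Lemma Ek_qfun k : 0 < k -> 2 * delta * k < PI ->
  2 * delta * Ek delta k = qfun (2 * delta * k).
Proof.
move=> k0 kpi; set eta := 2 * delta * k.
have e0 : 0 < eta by rewrite /eta; nra.
have si : 0 < sin eta by apply: sin_gt_0.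
have cE : cabs (RtoC (2 * delta) * zeta delta k)%R = eta / sin eta.
  rewrite scaled_zeta // -/eta /cabs /=.
  have p0 : 0 <= eta / sin eta by apply: Rlt_le; apply: Rdiv_lt_0_compat.
  rewrite -[RHS](sqrt_square _ p0); congr sqrt.
  have cs := sin2_cos2 eta; rewrite /Rsqr in cs.
  transitivity (eta / sin eta * (eta / sin eta) * (sin eta * sin eta + cos eta * cos eta)).
    by field; lra.
  by rewrite cs; ring.
rewrite /Ek /Efun ReD ReN ReM ReD Re1 [Re (CLog _)]/= cE [Re (RtoC _)]/= [Im (RtoC _)]/=.
have -> : Re (zeta delta k) = k * (cos eta / sin eta).
  by rewrite /zeta; case: Req_EM_T => [e|_] //=; lra.
by rewrite /qfun /eta; field; rewrite -/eta; lra.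
Qed.

(** Only the difference u - E enters a. For u_0 >= E, a lies in [-1/e, 0) and both branches are
    real. *)
Lemma aa_Ek k u : 0 < k -> 2 * delta * k < PI ->
  aa delta k u = - exp (- (1) - 2 * delta * (u - Ek delta k)).
Proof.
move=> k0 kpi; set eta := 2 * delta * k.
have e0 : 0 < eta by rewrite /eta; nra.
have si : 0 < sin eta by apply: sin_gt_0.
have -> : - (1) - 2 * delta * (u - Ek delta k) = (qfun eta - 1) + - (2 * delta * u).
  by rewrite -Ek_qfun //; ring.
rewrite exp_plus -exp_qfun // /aa.
have -> : (RtoC (2 * delta) * (zeta delta k + RtoC u))%R =
    Complex (eta * (cos eta / sin eta) + 2 * delta * u) eta.
  rewrite GRing.mulrDr scaled_zeta // -/eta.
  by apply: complex_eq; rewrite ?ReD ?ImD ?ReM ?ImM /=; ring.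
rewrite scaled_zeta // -/eta ReM ReN ImN /cexp ReN ImN /= cos_neg sin_neg.
have -> : - (eta * (cos eta / sin eta) + 2 * delta * u) =
   - (eta * (cos eta / sin eta)) + - (2 * delta * u) by ring.
rewrite exp_plus; have cs := sin2_cos2 eta; rewrite /Rsqr in cs.
by rewrite -[RHS]Rmult_1_r -cs; field; lra.
Qed.

Lemma aa_0 u : aa delta 0 u = - exp (- (1) - 2 * delta * u).
Proof.
rewrite /aa /zeta; case: Req_EM_T => [?|//].
have -> : (RtoC (2 * delta) * (RtoC (/ (2 * delta)) + RtoC u))%R = RtoC (1 + 2 * delta * u).
  by apply: complex_eq; rewrite ?ReM ?ImM ?ReD ?ImD /=; field; lra.
have -> : (RtoC (2 * delta) * RtoC (/ (2 * delta)))%R = 1%R.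
  by apply: complex_eq; rewrite ?ReM ?ImM ?Re1 ?Im1 /=; field; lra.
rewrite ReM ReN ImN Re1 Im1 /cexp ReN ImN /= Ropp_0 cos_0 sin_0.
have -> : - (1 + 2 * delta * u) = - (1) - 2 * delta * u by ring.
ring.
Qed.

Lemma Wyl_integrand_Ek k x : 0 < k -> 2 * delta * k < PI -> Ek delta k <= u0 x ->
  Wyl_integrand delta u0 k x = Wgap (2 * delta * (u0 x - Ek delta k)).
Proof.
move=> k0 kpi h; rewrite /Wyl_integrand aa_Ek // /Wgap Rmax_right; last nra.
by rewrite ReD ReN /negW0 /negWm1; ring.
Qed.

(** [- 0] displays kappa = 0 as the case E = 0 of [Wyl_integrand_Ek]. *)
Lemma Wyl_integrand_0 x : 0 < u0 x ->
  Wyl_integrand delta u0 0 x = Wgap (2 * delta * (u0 x - 0)).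
Proof.
move=> h; rewrite /Wyl_integrand aa_0 Rminus_0_r /Wgap Rmax_right; last nra.
by rewrite ReD ReN /negW0 /negWm1; ring.
Qed.

End Branches.

(** * Improper integrals of nonnegative functions *)

Lemma RInt_gen_le_bound (g : R -> R) : (forall x, continuous g x) -> (forall x, 0 <= g x) ->
  ex_RInt_gen g (Rbar_locally m_infty) (Rbar_locally p_infty) ->
  exists L, forall a b, a <= b -> RInt g a b <= L.
Proof.
move=> cg g0 [L hL]; exists (L + 1) => a b ab.
have ex c d : ex_RInt g c d by apply: ex_RInt_continuous => x _; apply: cg.
(* Far out, the partial integrals are within 1 of L; enlarging [a, b] to such an interval does not
   decrease the integral. *)
have [Q R' [M1 h1] [M2 h2] hQR] := hL _ (locally_ball L (mkposreal 1 Rlt_0_1)).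
pose a' := Rmin a M1 - 1; pose b' := Rmax b M2 + 1.
have a1 : a' < M1 by rewrite /a'; have := Rmin_r a M1; lra.
have a2 : a' < a by rewrite /a'; have := Rmin_l a M1; lra.
have b1 : M2 < b' by rewrite /b'; have := Rmax_r b M2; lra.
have b2 : b < b' by rewrite /b'; have := Rmax_l b M2; lra.
have [y [/= hy yL]] := hQR a' b' (h1 _ a1) (h2 _ b1).
have E : RInt g a' b' = y by apply: is_RInt_unique.
have C1 := RInt_Chasles g a' a b' (ex _ _) (ex _ _).
have C2 := RInt_Chasles g a b b' (ex _ _) (ex _ _).
have p1 := RInt_ge_0 g a' a (Rlt_le _ _ a2) (ex _ _) (fun x _ => g0 x).
have p2 := RInt_ge_0 g b b' (Rlt_le _ _ b2) (ex _ _) (fun x _ => g0 x).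
move: C1 C2; rewrite /plus /= E => C1 C2.
have {}yL : Rabs (y - L) < 1 := yL.
have := Rle_abs (y - L); lra.
Qed.

(** The integral is the supremum of its partial integrals. The last clause reaches any smaller value
    on a bounded interval. *)
Lemma is_RInt_gen_sup (f : R -> R) (L : R) : (forall x, continuous f x) -> (forall x, 0 <= f x) ->
  (forall a b, a <= b -> RInt f a b <= L) ->
  exists M, is_RInt_gen f (Rbar_locally m_infty) (Rbar_locally p_infty) M /\
    (forall a b, a <= b -> RInt f a b <= M) /\
    (forall v, v < M -> exists a b, a <= b /\ v < RInt f a b).
Proof.
move=> cf f0 hL.
have ex c d : ex_RInt f c d by apply: ex_RInt_continuous => x _; apply: cf.
pose S v := exists a b, a <= b /\ v = RInt f a b.
have [M [ub lub]] : {M | is_lub S M}.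
  apply: completeness.
    by exists L => v [a [b [ab ->]]]; apply: hL.
  by exists (RInt f 0 0), 0, 0; split => //; apply: Rle_refl.
have hM a b : a <= b -> RInt f a b <= M by move=> ab; apply: ub; exists a, b.
have hv v : v < M -> exists a b, a <= b /\ v < RInt f a b.
  move=> vM; apply: NNPP => h.
  have : M <= v; last lra.
  apply: lub => w [a [b [ab ->]]].
  by have [//|lt] := Rle_lt_dec (RInt f a b) v; case: h; exists a, b.
exists M; split => // P [e he].
have [a [b [ab hab]]] := hv (M - e) (ltac:(have := cond_pos e; lra)).
apply: (Filter_prod _ _ _ (fun x => x < a) (fun x => b < x)).
- by exists a.
- by exists b.
move=> a' b' /= ha hb; exists (RInt f a' b'); split; first exact: RInt_correct.
apply: he.
have C1 := RInt_Chasles f a' a b' (ex _ _) (ex _ _).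
have C2 := RInt_Chasles f a b b' (ex _ _) (ex _ _).
have p1 := RInt_ge_0 f a' a (Rlt_le _ _ ha) (ex _ _) (fun x _ => f0 x).
have p2 := RInt_ge_0 f b b' (Rlt_le _ _ hb) (ex _ _) (fun x _ => f0 x).
have p3 := hM a' b' (ltac:(lra)).
move: C1 C2; rewrite /plus /= => C1 C2.
change (Rabs (RInt f a' b' - M) < e).
by apply/Rabs_def1; have := cond_pos e; lra.
Qed.

Lemma Wmod_small e : 0 < e -> exists d, 0 < d /\ forall r, 0 <= r < d -> Wmod r < e.
Proof.
move=> e0; have p : 0 < Rmin (e / 4) (e ^ 2 / 32).
  by apply: Rmin_pos; [lra|have := pow_lt e 2 e0; lra].
(* Each of the two summands of [Wmod] is then below e / 2. *)
exists (Rmin (e / 4) (e ^ 2 / 32)); split => // r [r0 rd].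
have := Rmin_l (e / 4) (e ^ 2 / 32); have := Rmin_r (e / 4) (e ^ 2 / 32) => h1 h2.
have : sqrt (2 * r) < e / 4.
  rewrite -(sqrt_square (e / 4)); last lra.
  by apply: sqrt_lt_1_alt; split; [lra|nra].
rewrite /Wmod; lra.
Qed.

Lemma Wgap_continuous s : continuous Wgap s.
Proof.
apply/continuity_pt_filterlim => e e0.
have [d [d0 hd]] := Wmod_small e e0.
exists d; split => // s' [_ h]; rewrite /= /Rdist in h *.
apply: Rle_lt_trans (Wgap_modulus _ _) _; apply: hd; split => //; exact: Rabs_pos.
Qed.

Section WeylLaw.
Variables (delta : R) (u0 : R -> R) (xmax : R).
Hypotheses (delta0 : 0 < delta) (hd : forall x, ex_derive u0 x)
  (hu : forall x, 0 < u0 x) (hp : is_lim u0 p_infty 0) (hm : is_lim u0 m_infty 0)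
  (hmax : forall x, u0 x <= u0 xmax) (hc : forall x, Derive u0 x = 0 -> x = xmax)
  (hsq : ex_RInt_gen (fun x => sqrt (u0 x)) (Rbar_locally m_infty) (Rbar_locally p_infty)).

(** [Wgap] vanishes where u_0 < E, so J A B E computes the Weyl integral on any [A, B] that contains
    [x_-, x_+]. *)
Let F (E x : R) := Wgap (2 * delta * (u0 x - E)).
Let J (A B E : R) := RInt (F E) A B.

Lemma F_continuous E x : continuous (F E) x.
Proof.
apply: (continuous_comp (fun x => 2 * delta * (u0 x - E)) Wgap); last exact: Wgap_continuous.
by apply: ex_derive_continuous; auto_derive; exact: hd.
Qed.

Lemma F_ex_RInt E A B : ex_RInt (F E) A B.
Proof. by apply: ex_RInt_continuous => x _; apply: F_continuous. Qed.

Lemma J_continuity A B : A <= B -> continuity (J A B).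
Proof.
move=> AB E e e0.
have ep : 0 < e / (B - A + 1) by apply: Rdiv_lt_0_compat; lra.
have [d [d0 hdl]] := Wmod_small _ ep.
exists (d / (2 * delta)); split; first by apply: Rdiv_lt_0_compat; lra.
move=> E' [_ h]; rewrite /= /Rdist in h *.
have -> : J A B E' - J A B E = RInt (fun x => minus (F E' x) (F E x)) A B.
  by rewrite RInt_minus; [|exact: F_ex_RInt|exact: F_ex_RInt].
have Wl : Wmod (2 * delta * Rabs (E' - E)) < e / (B - A + 1).
  apply: hdl; split; first by have := Rabs_pos (E' - E); nra.
  by move: h => /Rlt_div_r; lra.
apply: Rle_lt_trans (abs_RInt_le_const _ A B (Wmod (2 * delta * Rabs (E' - E))) AB _ _) _.
- by apply: (ex_RInt_minus (F E') (F E)); apply: F_ex_RInt.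
- move=> x _; change (Rabs (F E' x - F E x) <= Wmod (2 * delta * Rabs (E' - E))).
  apply: Rle_trans (Wgap_modulus _ _) _; right; congr Wmod.
  have -> : 2 * delta * (u0 x - E') - 2 * delta * (u0 x - E) = 2 * delta * - (E' - E) by ring.
  by rewrite Rabs_mult Rabs_Ropp Rabs_pos_eq //; lra.
apply: Rle_lt_trans (_ : (B - A) * (e / (B - A + 1)) < e).
  by apply: Rmult_le_compat_l; lra.
have -> : (B - A) * (e / (B - A + 1)) = e - e / (B - A + 1) by field; lra.
lra.
Qed.

Lemma u0_small E : 0 < E -> exists A B, forall x, (x <= A -> u0 x < E) /\ (B <= x -> u0 x < E).
Proof.
move=> E0.
have [M1 h1] := proj2 (is_lim_spec _ _ _) hm (mkposreal E E0).
have [M2 h2] := proj2 (is_lim_spec _ _ _) hp (mkposreal E E0).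
exists (M1 - 1), (M2 + 1) => x; split => hx.
  by have := h1 x (ltac:(lra)); rewrite /= Rminus_0_r; have := Rle_abs (u0 x); lra.
by have := h2 x (ltac:(lra)); rewrite /= Rminus_0_r; have := Rle_abs (u0 x); lra.
Qed.

Lemma u0_continuity x : continuity_pt u0 x.
Proof. by apply/continuity_pt_filterlim; apply: ex_derive_continuous; apply: hd. Qed.

Lemma xplus_spec k : 0 < Ek delta k < u0 xmax ->
  xmax <= xplus delta u0 xmax k /\ u0 (xplus delta u0 xmax k) = Ek delta k.
Proof.
move=> [E0 E1]; apply: (epsilon_spec (inhabits 0) (fun x => xmax <= x /\ u0 x = Ek delta k)).
have [A [B hAB]] := u0_small _ E0.
pose b := Rmax B (xmax + 1).
have [_ /(_ (Rmax_l _ _)) hb] := hAB b.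
have b1 : xmax < b by rewrite /b; have := Rmax_r B (xmax + 1); lra.
have [|x [hx ex]] := IVT_interv (fun x => Ek delta k - u0 x) xmax b _ b1 (ltac:(cbv beta; lra)) (ltac:(cbv beta; lra)).
  move=> x _; apply: continuity_pt_minus; last exact: u0_continuity.
  by apply: continuity_pt_const => ? ?.
by exists x; lra.
Qed.

Lemma xminus_spec k : 0 < Ek delta k < u0 xmax ->
  xminus delta u0 xmax k <= xmax /\ u0 (xminus delta u0 xmax k) = Ek delta k.
Proof.
move=> [E0 E1]; apply: (epsilon_spec (inhabits 0) (fun x => x <= xmax /\ u0 x = Ek delta k)).
have [A [B hAB]] := u0_small _ E0.
pose a := Rmin A (xmax - 1).
have [/(_ (Rmin_l _ _)) ha _] := hAB a.
have a1 : a < xmax by rewrite /a; have := Rmin_r A (xmax - 1); lra.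
have [|x [hx ex]] := IVT_interv (fun x => u0 x - Ek delta k) a xmax _ a1 (ltac:(cbv beta; lra)) (ltac:(cbv beta; lra)).
  move=> x _; apply: continuity_pt_minus; first exact: u0_continuity.
  by apply: continuity_pt_const => ? ?.
by exists x; lra.
Qed.

Lemma RInt_F_eq0 E a b : a <= b -> (forall x, a <= x <= b -> u0 x <= E) -> RInt (F E) a b = 0.
Proof.
move=> ab h.
rewrite (RInt_ext (F E) (fun=> 0)).
  by rewrite RInt_const; apply: Rmult_0_r.
move=> x; rewrite Rmin_left // Rmax_right // => hx.
by rewrite /F Wgap_0 //; have := h x (ltac:(lra)); nra.
Qed.

Lemma RWyl_RInt k A B : 0 < k -> 2 * delta * k < PI -> 0 < Ek delta k < u0 xmax ->
  (forall x, (x <= A -> u0 x < Ek delta k) /\ (B <= x -> u0 x < Ek delta k)) ->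
  RWyl delta u0 xmax k = / (4 * delta) * J A B (Ek delta k).
Proof.
move=> k0 kpi hE hAB; rewrite /RWyl; case: Req_EM_T => [e|?]; first lra.
congr (_ * _).
have [p1 p2] := xplus_spec k hE; have [m1 m2] := xminus_spec k hE.
set xp := xplus _ _ _ _ in p1 p2 *; set xm := xminus _ _ _ _ in m1 m2 *.
have Am : A <= xm.
  have [//|l] := Rle_lt_dec A xm; have := proj1 (hAB xm) (Rlt_le _ _ l); lra.
have pB : xp <= B.
  have [//|l] := Rle_lt_dec xp B; have := proj2 (hAB xp) (Rlt_le _ _ l); lra.
have inc := unimodal_increasing u0 xmax hd hu hm hc.
have dec := unimodal_decreasing u0 xmax hd hu hp hc.
rewrite (RInt_ext _ (F (Ek delta k))); last first.
  rewrite Rmin_left; last lra; rewrite Rmax_right; last lra.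
  move=> x hx; apply: Wyl_integrand_Ek => //.
  have [l|l] := Rle_lt_dec x xmax.
    by rewrite -m2; apply: inc; lra.
  by rewrite -p2; apply: dec; lra.
have C1 := RInt_Chasles (F (Ek delta k)) A xm B (F_ex_RInt _ _ _) (F_ex_RInt _ _ _).
have C2 := RInt_Chasles (F (Ek delta k)) xm xp B (F_ex_RInt _ _ _) (F_ex_RInt _ _ _).
have z1 : RInt (F (Ek delta k)) A xm = 0.
  by apply: RInt_F_eq0 => // x hx; rewrite -m2; apply: inc; lra.
have z2 : RInt (F (Ek delta k)) xp B = 0.
  by apply: RInt_F_eq0 => // x hx; rewrite -p2; apply: dec; lra.
by move: C1 C2; rewrite /J /plus /= z1 z2; lra.
Qed.

Lemma F0_bound : exists L, forall a b, a <= b -> RInt (F 0) a b <= L.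
Proof.
have cs x : continuous (fun x => sqrt (u0 x)) x.
  apply: (continuous_comp u0 sqrt); first by apply: ex_derive_continuous; apply: hd.
  by apply/continuity_pt_filterlim; apply: continuity_pt_sqrt; apply: Rlt_le.
have [L hL] := RInt_gen_le_bound _ cs (fun x => sqrt_pos (u0 x)) hsq.
(* From Wgap s <= 2 s + 2 sqrt (2 s) at s = 2 delta u_0, where one factor sqrt s of the linear term
   is bounded by its value at xmax. *)
pose c := 2 * sqrt (2 * delta * u0 xmax) * sqrt (2 * delta) + 2 * sqrt (2 * (2 * delta)).
have c0 : 0 <= c.
  rewrite /c; have := sqrt_pos (2 * delta * u0 xmax); have := sqrt_pos (2 * delta).
  by have := sqrt_pos (2 * (2 * delta)); nra.
exists (c * L) => a b ab.
apply: Rle_trans (_ : RInt (fun x => scal c (sqrt (u0 x))) a b <= _); last first.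
  rewrite RInt_scal; last by apply: ex_RInt_continuous => x _; apply: cs.
  by apply: Rmult_le_compat_l => //; apply: hL.
apply: RInt_le => //; first exact: F_ex_RInt.
  apply: ex_RInt_continuous => x _.
  by apply: (continuous_mult (fun=> c) (fun x => sqrt (u0 x))) => //; apply: continuous_const.
move=> x _; rewrite /F Rminus_0_r.
have ux := hu x.
have s0 : 0 <= 2 * delta * u0 x by nra.
have := Wgap_modulus (2 * delta * u0 x) 0.
rewrite (Wgap_0 0) // ?Rminus_0_r; last lra.
rewrite (Rabs_pos_eq (Wgap _)); last exact: Wgap_ge0.
rewrite (Rabs_pos_eq (2 * delta * u0 x)) // => h; apply: Rle_trans h _.
change (Wmod (2 * delta * u0 x) <= c * sqrt (u0 x)).
rewrite /Wmod /c.
have -> : 2 * (2 * delta * u0 x) = 2 * (2 * delta) * u0 x by ring.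
rewrite (sqrt_mult (2 * (2 * delta))); [|lra|lra].
have E : 2 * (2 * delta) * u0 x = 2 * (sqrt (2 * delta * u0 x) * sqrt (2 * delta * u0 x)).
  by rewrite sqrt_sqrt //; ring.
rewrite E {2}(sqrt_mult (2 * delta)); [|lra|lra].
have l : sqrt (2 * delta * u0 x) <= sqrt (2 * delta * u0 xmax).
  by apply: sqrt_le_1_alt; have := hmax x; nra.
have q : 0 <= sqrt (2 * delta) * sqrt (u0 x) by apply: Rmult_le_pos; apply: sqrt_pos.
have := Rmult_le_compat_r _ _ _ q l; lra.
Qed.

Lemma RWyl_0 : exists M, [/\ 0 < M, RWyl delta u0 xmax 0 = / (4 * delta) * M &
  forall v, v < M -> exists a b, a <= b /\ v < J a b 0].
Proof.
have [L hL] := F0_bound.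
have [M [hM [ub lub]]] := is_RInt_gen_sup (F 0) L (F_continuous 0) (fun x => Wgap_ge0 _) hL.
exists M; split => //.
  apply: Rlt_le_trans (ub 0 1 Rle_0_1).
  apply: RInt_gt_0 => [|x _|x _]; first exact: Rlt_0_1; last exact: F_continuous.
  by apply: Wgap_gt0; have := hu x; nra.
rewrite /RWyl; case: Req_EM_T => [?|//]; congr (_ * _).
have -> : Wyl_integrand delta u0 0 = F 0.
  by apply: functional_extensionality => x; apply: Wyl_integrand_0.
exact (is_RInt_gen_unique (F 0) M hM).
Qed.

(** J A B is continuous in E on a fixed interval, exceeds v at a small E1 > 0 and is 0 at the
    maximum of u_0. The energy found in between is converted to kappa by [qfun_surj]. *)
Lemma exists_RWyl_eq M v : (forall v, v < M -> exists a b, a <= b /\ v < J a b 0) -> 0 < v < M ->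
  exists k, 0 < k < kappa_max delta u0 xmax /\ RWyl delta u0 xmax k = / (4 * delta) * v.
Proof.
move=> hM [v0 vM].
have [a [b [ab hab]]] := hM v vM.
have um := hu xmax.
(* E = 0 has no finite x_-, x_+; continuity at 0 allows moving to a positive energy while keeping J
   above v. *)
have [E1 [[E10 E1m] hE1]] : exists E1, 0 < E1 < u0 xmax /\ v < J a b E1.
  have [d [d0 hdl]] := J_continuity a b ab 0 (J a b 0 - v) (ltac:(lra)).
  pose E1 := Rmin (d / 2) (u0 xmax / 2).
  have e0 : 0 < E1 by apply: Rmin_pos; lra.
  have e1 := Rmin_l (d / 2) (u0 xmax / 2); have e2 := Rmin_r (d / 2) (u0 xmax / 2).
  rewrite -/E1 in e1 e2; exists E1; split; first lra.
  have e3 : Rabs (E1 - 0) < d by rewrite Rminus_0_r Rabs_pos_eq; lra.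
  have h : Rabs (J a b E1 - J a b 0) < J a b 0 - v := hdl E1 (conj (conj I (Rlt_not_eq _ _ e0)) e3).
  by have := Rle_abs (- (J a b E1 - J a b 0)); rewrite Rabs_Ropp; lra.
(* Outside [A0, B0] u_0 is below E1, hence below every E >= E1, so one interval serves all these
   energies. *)
have [A0 [B0 hAB0]] := u0_small E1 E10.
pose A := Rmin A0 a; pose B := Rmax B0 b.
have A1 : A <= A0 by apply: Rmin_l. have A2 : A <= a by apply: Rmin_r.
have B1 : B0 <= B by apply: Rmax_l. have B2 : b <= B by apply: Rmax_r.
have hJ1 : v < J A B E1.
  have C1 := RInt_Chasles (F E1) A a B (F_ex_RInt _ _ _) (F_ex_RInt _ _ _).
  have C2 := RInt_Chasles (F E1) a b B (F_ex_RInt _ _ _) (F_ex_RInt _ _ _).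
  have q1 := RInt_ge_0 (F E1) A a A2 (F_ex_RInt _ _ _) (fun x _ => Wgap_ge0 _).
  have q2 := RInt_ge_0 (F E1) b B B2 (F_ex_RInt _ _ _) (fun x _ => Wgap_ge0 _).
  by move: C1 C2; rewrite /J /plus /= in hE1 *; lra.
have hJ2 : J A B (u0 xmax) = 0 by apply: RInt_F_eq0 => // ; lra.
have [|E [hE eE]] := IVT_interv (fun E => v - J A B E) E1 (u0 xmax) _ E1m (ltac:(cbv beta; lra)) (ltac:(cbv beta; lra)).
  move=> E _; apply: continuity_pt_minus; first by apply: continuity_pt_const => ? ?.
  by apply: J_continuity; lra.
have EJ : J A B E = v by lra.
have Em : E < u0 xmax by case: (proj2 hE) => // e; move: eE; rewrite e hJ2; lra.
have [eta [heta qeta]] := qfun_surj (2 * delta * E) (ltac:(nra)).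
have [km0 [km1 km2]] := kappa_max_spec delta u0 xmax delta0 um.
pose k := eta / (2 * delta).
have kE : 2 * delta * k = eta by rewrite /k; field; lra.
have k0 : 0 < k by apply: Rdiv_lt_0_compat; lra.
(* E is below the maximum of u_0, and [qfun] is strictly increasing. *)
have kk : k < kappa_max delta u0 xmax.
  have [//|l] := Rlt_le_dec k (kappa_max delta u0 xmax).
  have : qfun (2 * delta * kappa_max delta u0 xmax) <= qfun eta.
    case: (Rle_lt_or_eq_dec _ _ l) => [l'|->]; last by rewrite kE; lra.
    by apply: Rlt_le; apply: qfun_lt; rewrite -?kE; nra.
  by rewrite km2 qeta; nra.
exists k; split => //.
have EkE : Ek delta k = E.
  have := Ek_qfun delta delta0 k k0; rewrite kE qeta => /(_ (proj2 heta)) h.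
  by apply: (Rmult_eq_reg_l (2 * delta)); lra.
rewrite (RWyl_RInt k A B) ?EkE ?EJ // ?kE; try lra.
by move=> x; split => hx; [have := proj1 (hAB0 x)|have := proj2 (hAB0 x)]; lra.
Qed.

Lemma epsN_gt0 N : (0 < N)%nat -> 0 < epsN delta u0 xmax N.
Proof.
move=> N0; have [M [M0 ME _]] := RWyl_0.
rewrite /epsN ME; have i0 : 0 < / (4 * delta) by apply: Rinv_0_lt_compat; lra.
apply: Rdiv_lt_0_compat; first nra.
by apply: Rmult_lt_0_compat; [exact: PI_RGT_0|apply: lt_0_INR; apply/ltP].
Qed.

Lemma kappa_n_spec N n : (0 < n <= N)%nat ->
  0 < kappa_n delta u0 xmax N n < kappa_max delta u0 xmax /\
  RWyl delta u0 xmax (kappa_n delta u0 xmax N n) = PI * (INR n - / 2) * epsN delta u0 xmax N.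
Proof.
move=> /andP [n0 nN].
apply: (epsilon_spec (inhabits 0) (fun k => 0 < k < kappa_max delta u0 xmax /\
     RWyl delta u0 xmax k = PI * (INR n - / 2) * epsN delta u0 xmax N)).
have [M [M0 ME hM]] := RWyl_0.
have n1 : 1 <= INR n by apply: (le_INR 1); apply/leP.
have nN' : INR n <= INR N by apply: le_INR; apply/leP.
(* pi (n - 1/2) eps_N is the fraction (n - 1/2) / N of R^Wyl(0), strictly between 0 and 1 for 1 <= n
   <= N. *)
have vM : 0 < (INR n - / 2) / INR N * M < M.
  have h1 : 0 < (INR n - / 2) / INR N by apply: Rdiv_lt_0_compat; lra.
  have h2 : (INR n - / 2) / INR N < 1 by apply/Rlt_div_l; lra.
  by move: (_ / INR N) h1 h2 => r *; nra.
have [k [hk1 hk2]] := exists_RWyl_eq M _ hM vM.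
exists k; split => //; rewrite hk2 /epsN ME; field.
by have := PI_RGT_0; repeat split; lra.
Qed.

(** Equal points would give equal values pi (n - 1/2) eps_N of R^Wyl, and eps_N > 0 keeps these
    distinct. *)
Lemma kappa_n_inj N : injective (fun i : 'I_N => kappa_n delta u0 xmax N i.+1).
Proof.
move=> i j e; have N0 : (0 < N)%nat by apply: leq_ltn_trans (ltn_ord i).
have [_ hi] := kappa_n_spec N i.+1 (ltn_ord i); have [_ hj] := kappa_n_spec N j.+1 (ltn_ord j).
have e0 := epsN_gt0 N N0; have p0 := PI_RGT_0.
move: hi; rewrite /= in e; rewrite e hj => h.
have {}h : (INR j.+1 - / 2) * (PI * epsN delta u0 xmax N) = (INR i.+1 - / 2) * (PI * epsN delta u0 xmax N) by lra.
have pe : PI * epsN delta u0 xmax N <> 0 by apply: Rgt_not_eq; apply: Rmult_lt_0_compat.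
have := Rmult_eq_reg_r _ _ _ h pe => hij.
have /INR_eq : INR i.+1 = INR j.+1 by lra.
by case=> ?; apply/val_inj.
Qed.

End WeylLaw.

Theorem mainTheorem3 (delta : R) (u0 : R -> R) (xmax : R) :
  0 < delta ->
  (* u0 is C^1 *)
  (forall x, ex_derive u0 x) ->
  (forall x, continuous (Derive u0) x) ->
  (* u0 > 0, u0 -> 0 at +-oo *)
  (forall x, 0 < u0 x) ->
  is_lim u0 p_infty 0 -> is_lim u0 m_infty 0 ->
  (* int (x^2+1) u0 < oo *)
  ex_RInt_gen (fun x => (x ^ 2 + 1) * u0 x) (Rbar_locally m_infty) (Rbar_locally p_infty) ->
  (* u0 attains its maximum at xmax, and u0' vanishes only at xmax *)
  (forall x, u0 x <= u0 xmax) ->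
  (forall x, Derive u0 x = 0 -> x = xmax) ->
  (* standing assumption: int sqrt u0 < oo *)
  ex_RInt_gen (fun x => sqrt (u0 x)) (Rbar_locally m_infty) (Rbar_locally p_infty) ->
  forall (N : nat) (t : R), (0 < N)%nat ->
  let eps := epsN delta u0 xmax N in
  let kmax := kappa_max delta u0 xmax in
  let Z := fun x y => ZN delta u0 xmax N (Complex x y) t in
  (forall x y, Rabs y <= delta * eps ->
     0 < dfun (2 * kmax * Rabs y / eps) ^ N /\
     dfun (2 * kmax * Rabs y / eps) ^ N <= cabs (Z x y) /\
     cabs (Z x y) <= 2 ^ N * exp (- (2 / (PI * eps ^ 2)) * EminN delta u0 xmax N x t)) /\
  (forall x y, Rabs y <= delta * eps -> Z x y <> RtoC 0) /\
  (forall x, Im (Z x 0) = 0 /\ 0 < Re (Z x 0)) /\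
  (exists phi : R -> R -> R,
     continuous_on_strip (delta * eps) phi /\
     (forall x, phi x 0 = 0) /\
     (forall x y, Rabs y <= delta * eps ->
        Z x y = Complex (cabs (Z x y) * cos (phi x y)) (cabs (Z x y) * sin (phi x y)))) /\
  (forall phi : R -> R -> R,
     continuous_on_strip (delta * eps) phi ->
     (forall x, phi x 0 = 0) ->
     (forall x y, Rabs y <= delta * eps ->
        Z x y = Complex (cabs (Z x y) * cos (phi x y)) (cabs (Z x y) * sin (phi x y))) ->
     forall x y, Rabs y <= delta * eps ->
       0 <= - sgn y * phi x y <= 2 * INR N * kmax * Rabs y / eps).
Proof.
move=> delta0 hd _ hu hp hm _ hmax hc hsq N t N0 eps kmax Z.
have [k0 [kpi _]] := kappa_max_spec delta u0 xmax delta0 (hu xmax).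
apply: strip_conclusion => //.
- exact: epsN_gt0.
- by move=> i; apply: (proj1 (kappa_n_spec _ _ _ _ _ _ _ _ _ _ _ N i.+1 (ltn_ord i))).
- exact: kappa_n_inj.
Qed.
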